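(* Let $\psi:\mathbb{R}_{>0}\to\mathbb{R}_{>0}$ and $0<s\le 1$. Assume that the function $x\mapsto x^2\psi(x)^s$ is non-increasing and tends to $0$ as $x\to\infty$. Then $$\mathcal{H}^s(E(\psi))=\begin{cases}0 & \text{if } \sum_{n=1}^\infty n\,\psi(n)^s<\infty,\\ \mathcal{H}^s((0,1)) & \text{if } \sum_{n=1}^\infty n\,\psi(n)^s=\infty.\end{cases}$$
   Context: $\mathcal{H}^s$ denotes the $s$-dimensional Hausdorff measure on $\mathbb{R}$, i.e. $\mathcal{H}^s(E)=\lim_{\delta\to0}\inf\{\sum_i \mathrm{diam}(U_i)^s\}$, the infimum being over countable covers $\{U_i\}$ of $E$ by sets with $0<\mathrm{diam}(U_i)\le\delta$. (So $\mathcal{H}^s((0,1))=\infty$ for $s<1$ and $\mathcal{H}^1((0,1))=1$.) For $\psi:\mathbb{R}_{>0}\to\mathbb{R}_{>0}$, the set $E(\psi)$ is $$E(\psi)=\bigcap_{0<\epsilon<1}\left\{x\in[0,1]: (1-\epsilon)\psi(q)<\left|x-\frac pq\right|<\psi(q)\ \text{for infinitely many } (p,q)\in\mathbb{Z}\times\mathbb{N}\right\},$$ where $\mathbb{N}$ is the set of positive integers. *)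

(* Defs.v *)
From HB Require Import structures.
From mathcomp Require Import all_boot all_order all_algebra.
From mathcomp Require Import all_classical all_reals all_analysis.
Import Order.TTheory GRing.Theory Num.Theory.
Import numFieldNormedType.Exports.

Set Implicit Arguments.
Unset Strict Implicit.
Unset Printing Implicit Defensive.

Local Open Scope classical_set_scope.
Local Open Scope ring_scope.

(* The supremum of an empty set is -oo, so [diam set0 = -oo]; the requirement
   [0 < diam U] below therefore also excludes the empty set. *)
Definition diam (R : realType) (U : set R) : \bar R :=
  ereal_sup [set (`|z.1 - z.2|)%:E | z in U `*` U].

(* Finite as well as infinite families are allowed: the index set [D] is an
   arbitrary set of natural numbers. *)
Definition diam_cover (R : realType) (delta : R) (E : set R)
    (D : set nat) (U : nat -> set R) : Prop :=
  (forall i, D i -> (0 < diam (U i) <= delta%:E)%E) /\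
  E `<=` \bigcup_(i in D) U i.

Definition hausdorff_premeasure (R : realType) (s delta : R) (E : set R)
    : \bar R :=
  ereal_inf [set \esum_(i in DU.1) (diam (DU.2 i) `^ s)%E
            | DU in [set DU : set nat * (nat -> set R)
                    | diam_cover delta E DU.1 DU.2]].

(* [hausdorff_premeasure s delta E] is nonincreasing in [delta], so the limit
   exists in [\bar R]. *)
Definition hausdorff_measure (R : realType) (s : R) (E : set R) : \bar R :=
  lim (hausdorff_premeasure s delta E @[delta --> 0^'+]).

(* Infinitely many pairs (p, q) are required, not infinitely many reduced
   fractions. Only the values of [psi] at positive integers matter. *)
Definition exact_approx_set (R : realType) (psi : R -> R) : set R :=
  \bigcap_(eps in `]0%R, 1%R[%classic)
    [set x : R | x \in `[0, 1] /\
      infinite_set [set pq : int * nat | (0 < pq.2)%N /\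
        (1 - eps) * psi pq.2%:R < `|x - pq.1%:~R / pq.2%:R| < psi pq.2%:R]].

(* Main.v *)
(* In the convergence case the natural covers by intervals of length
   2 psi(q) around the fractions p/q show that the measure vanishes.

   In the divergence case put Psi = psi^s. The claim is that no family of
   intervals U_i with sum |U_i|^s finite and sum |U_i| < 1 covers the exact
   approximation set inside (0, 1); for |U_i| <= delta this bounds the
   delta-premeasure below by delta^(s-1), which tends to +oo if s < 1 and is
   the measure of (0, 1) if s = 1. An uncovered point is the limit of nested
   intervals J such that the U_i meeting J have total length less than |J|.
   Given J, forbid finitely many U_i, so that the remaining ones have a tiny
   s-sum. What is left of J has length bounded below, and by divergence it
   contains finitely many fractions p/q that are 4 Psi(q)-separated and have
   sum Psi(q) bounded below: Dirichlet's theorem provides many fractions with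
   q in a block ]M^k, M^(k+1)], and 1/(qq') <= |p/q - p'/q'| limits how many
   are close to those of earlier blocks. By pigeonhole, the remaining U_i that
   meet [p/q, p/q + Psi(q)] have s-sum at most kappa Psi(q) = kappa psi(q)^s
   for some p/q. As s <= 1, their lengths then sum to at most
   kappa^(1/s) psi(q), so [p/q + (1 - eps/2) psi(q), p/q + (1 - eps/4) psi(q)]
   is a possible next interval. *)

Require Import Defs.
From HB Require Import structures.
From mathcomp Require Import all_boot all_order all_algebra.
From mathcomp Require Import all_classical all_reals all_analysis.
From mathcomp Require Import zify ring lra.
Import Order.TTheory GRing.Theory Num.Theory.
Import numFieldNormedType.Exports.

Set Implicit Arguments.
Unset Strict Implicit.
Unset Printing Implicit Defensive.

Local Open Scope classical_set_scope.
Local Open Scope ring_scope.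

(** * Finite packings and coverings, approximation of reals by fractions *)

(** Induction on the number of centres: one centre [c x] splits the other intervals into those in
    [a, c x - r x] and those in [c x + r x, b]. *)
Lemma packing_length (R : realFieldType) (T : eqType) (s : seq T) (c r : T -> R)
    (a b : R) :
  a <= b -> uniq s ->
  {in s, forall x, a <= c x - r x /\ c x + r x <= b} ->
  {in s &, forall x y, x != y -> r x + r y <= `|c x - c y|} ->
  \sum_(x <- s) 2 * r x <= b - a.
Proof.
have [n] := ubnP (size s); elim: n s a b => // n IHn [|x t] a b.
  by rewrite big_nil => _ ab *; rewrite subr_ge0.
rewrite ltnS => /= tn ab /andP[xt ut] inab sep.
have [axr xrb] := inab x (mem_head _ _).
have sz (p : pred T) : (size [seq x <- t | p x] < n)%N.
  by rewrite (leq_ltn_trans _ tn)// size_filter count_size.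
rewrite big_cons (bigID (fun y => c y <= c x))/= -big_filter.
rewrite -[X in _ + (_ + X)]big_filter.
have tx y : y \in t -> y != x by move=> yt; apply: contraNneq xt => <-.
have L : \sum_(y <- [seq y <- t | c y <= c x]) 2 * r y <= (c x - r x) - a.
  apply: IHn => //; first exact: filter_uniq.
    move=> y; rewrite mem_filter => /andP[yx yt].
    have [ay _] := inab y (mem_behead (s := x :: t) yt).
    split=> //.
    have := sep y x (mem_behead (s := x :: t) yt) (mem_head _ _) (tx y yt).
    by rewrite ler0_norm ?subr_le0//; lra.
  move=> y z; rewrite !mem_filter => /andP[_ yt] /andP[_ zt].
  by apply: sep; rewrite inE ?yt ?zt orbT.
have U : \sum_(y <- [seq y <- t | ~~ (c y <= c x)]) 2 * r y <= b - (c x + r x).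
  apply: IHn => //; first exact: filter_uniq.
    move=> y; rewrite mem_filter -ltNge => /andP[yx yt].
    have [_ yb] := inab y (mem_behead (s := x :: t) yt).
    split=> //.
    have := sep y x (mem_behead (s := x :: t) yt) (mem_head _ _) (tx y yt).
    by rewrite gtr0_norm ?subr_gt0//; lra.
  move=> y z; rewrite !mem_filter => /andP[_ yt] /andP[_ zt].
  by apply: sep; rewrite inE ?yt ?zt orbT.
lra.
Qed.

Lemma separated_size (R : realFieldType) (T : eqType) (s : seq T) (c : T -> R)
    (rho a b : R) :
  0 < rho -> a <= b -> uniq s ->
  {in s, forall x, a <= c x <= b} ->
  {in s &, forall x y, x != y -> rho <= `|c x - c y|} ->
  (size s)%:R * rho <= b - a + rho.
Proof.
move=> rho0 ab us inab sep.
have := @packing_length R T s c (fun=> rho / 2) (a - rho / 2) (b + rho / 2).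
rewrite big_const_seq count_predT iter_addr_0 => h.
have /h : a - rho / 2 <= b + rho / 2 by lra.
move=> /(_ us); rewrite -[_ *+ size s]mulr_natl.
have -> : 2 * (rho / 2) = rho by lra.
have -> : b + rho / 2 - (a - rho / 2) = b - a + rho by lra.
apply.
- by move=> x /inab; lra.
- by move=> x y xs ys /(sep x y xs ys); lra.
Qed.

(** Induction on the number of intervals: an interval covering [b] is removed, and as it is open,
    the others still cover [a, I.1]. *)
Lemma open_cover_length (R : realFieldType) (s : seq (R * R)) (a b : R) :
  {in s, forall I, I.1 <= I.2} ->
  (forall y, a <= y <= b -> exists2 I, I \in s & I.1 < y < I.2) ->
  b - a <= \sum_(I <- s) (I.2 - I.1).
Proof.
have [n] := ubnP (size s); elim: n s b => // n IHn s b sn s0 cov.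
have sum0 (t : seq (R * R)) : {in t, forall I, I.1 <= I.2} ->
    0 <= \sum_(I <- t) (I.2 - I.1).
  by move=> t0; rewrite big_seq sumr_ge0// => I /t0; rewrite subr_ge0.
have [ba|ab] := ltP b a; first by apply: le_trans (sum0 s s0); lra.
have [I Is /andP[lb br]] := cov b (introT andP (conj ab (lexx b))).
rewrite (perm_big _ (perm_to_rem Is)) big_cons/=.
have rs J : J \in rem I s -> J \in s by move=> /mem_rem.
have := IHn (rem I s) I.1.
rewrite size_rem// => h.
suff : I.1 - a <= \sum_(J <- rem I s) (J.2 - J.1) by lra.
apply: h.
- by case: s sn Is {s0 cov rs}.
- by move=> J /rs; exact: s0.
- move=> y /andP[ay yl]; have yb : y <= b by lra.
  have [J Js Jy] := cov y (introT andP (conj ay yb)).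
  exists J => //; have : J \in I :: rem I s by rewrite -(perm_mem (perm_to_rem Is)).
  by rewrite inE => /orP[/eqP JI|//]; move: Jy; rewrite JI; lra.
Qed.

Lemma dirichlet (R : realType) (y : R) (Q : nat) : (0 < Q)%N ->
  exists (p : int) (q : nat), (0 < q <= Q)%N /\ `|q%:R * y - p%:~R| < Q%:R^-1.
Proof.
case: Q => // Q _.
pose fr (i : nat) : R := i%:R * y - (Num.floor (i%:R * y))%:~R.
have fr01 i : 0 <= fr i < 1.
  have := Num.Theory.floor_itv (i%:R * y); rewrite intrD /fr => /andP[? ?].
  by apply/andP; split; lra.
have Q0 : (0 : R) < Q.+1%:R by rewrite ltr0n.
(* Pigeonhole: Q + 2 fractional parts fall into Q + 1 boxes of length 1/(Q + 1), where [Q] is now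
   the predecessor of the given bound. *)
pose box (i : 'I_Q.+2) : 'I_Q.+1 := inord (Num.truncn (Q.+1%:R * fr i)).
have boxE i : box i = Num.truncn (Q.+1%:R * fr i) :> nat.
  rewrite inordK//.
  have /andP[f0 f1] := fr01 i.
  rewrite -(ltr_nat R) (@le_lt_trans _ _ (Q.+1%:R * fr i))//.
    by rewrite Num.Theory.truncn_le mulr_ge0// ltW.
  by rewrite -[ltRHS]mulr1 ltr_pM2l.
have boxP i : (box i)%:R <= Q.+1%:R * fr i < (box i)%:R + 1.
  rewrite boxE natr1; have /andP[f0 f1] := fr01 i.
  exact: Num.Theory.truncn_itv (mulr_ge0 (ltW Q0) f0).
have : ~~ injectiveb box.
  by apply/injectiveP => /leq_card; rewrite !card_ord ltnn.
rewrite /injectiveb => /injectivePn[i [j ij boxij]].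
wlog lij : i j ij boxij / (i < j)%N.
  move=> H; have [/H|/H|/val_inj] := ltngtP i j.
  - exact.
  - by apply => //; rewrite eq_sym.
  - by move/eqP: ij.
exists (Num.floor (j%:R * y) - Num.floor (i%:R * y)), (j - i)%N; split.
  by have := ltn_ord j; lia.
rewrite intrB natrB; last exact: ltnW.
have -> : (j%:R - i%:R) * y - ((Num.floor (j%:R * y))%:~R -
  (Num.floor (i%:R * y))%:~R) = fr j - fr i by rewrite /fr; ring.
rewrite -(ltr_pM2l Q0) divff ?gt_eqF// -{1}(gtr0_norm Q0) -normrM mulrBr.
have := boxP i; have := boxP j; rewrite boxij ltr_norml; lra.
Qed.

Lemma dirichlet_coprime (R : realType) (y : R) (Q : nat) : (0 < Q)%N ->
  0 <= y <= 1 ->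
  exists p q : nat, [/\ coprime p q, (0 < q <= Q)%N, (p <= q)%N &
    `|y - p%:R / q%:R| < (q%:R * Q%:R)^-1].
Proof.
move=> Q0 /andP[y0 y1]; have [p [q [/andP[q0 qQ] ypq]]] := dirichlet y Q0.
have Q1 : Q%:R^-1 <= 1 :> R by rewrite invf_le1 ?ltr0n// ler1n.
have q0R : 0 < q%:R :> R by rewrite ltr0n.
have Q0R : 0 < Q%:R :> R by rewrite ltr0n.
have qy0 : 0 <= q%:R * y by rewrite mulr_ge0// ltW.
have qyq : q%:R * y <= q%:R by rewrite -[leRHS]mulr1 ler_pM2l.
(* As y is in [0, 1], an error below 1 excludes p < 0 and p > q. *)
have p0 : (0 <= p)%R.
  rewrite leNgt; apply/negP => pn.
  have : p%:~R <= -1 :> R by rewrite -[leRHS]/((-1)%:~R) ler_int; lia.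
  by move: ypq; rewrite ltr_norml; lra.
case: p p0 ypq => // p _; rewrite -[(Posz p)%:~R]/(p%:R : R) => ypq.
have pq : (p <= q)%N.
  rewrite leqNgt; apply/negP => qp.
  have : q%:R + 1 <= p%:R :> R by rewrite natr1 ler_nat.
  by move: ypq; rewrite ltr_norml; lra.
have g0 : (0 < gcdn p q)%N by rewrite gcdn_gt0 q0 orbT.
have g0R : (gcdn p q)%:R != 0 :> R by rewrite pnatr_eq0 -lt0n.
exists (p %/ gcdn p q)%N, (q %/ gcdn p q)%N.
have qE : (q = q %/ gcdn p q * gcdn p q)%N by rewrite divnK// dvdn_gcdr.
have pE : (p = p %/ gcdn p q * gcdn p q)%N by rewrite divnK// dvdn_gcdl.
have q'0 : (0 < q %/ gcdn p q)%N by rewrite divn_gt0// dvdn_leq// dvdn_gcdr.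
have q'q : (q %/ gcdn p q <= q)%N by rewrite leq_div.
split.
- rewrite /coprime -(eqn_pmul2r g0) muln_gcdl -pE -qE mul1n.
  by [].
- by rewrite q'0 (leq_trans q'q).
- by rewrite leq_div2r.
- have -> : (p %/ gcdn p q)%:R / (q %/ gcdn p q)%:R = p%:R / q%:R :> R.
    rewrite [X in _ = X%:R / _]pE [X in _ = _ / X%:R]qE !natrM -mulf_div.
    by rewrite divff// mulr1.
  rewrite -(ltr_pM2l q0R) -{1}(gtr0_norm q0R) -normrM mulrBr.
  have -> : q%:R * (p%:R / q%:R) = p%:R :> R by rewrite mulrC divfK// gt_eqF.
  apply: (lt_le_trans ypq).
  rewrite invfM mulrA ler_peMl// ?invr_ge0 ?ler0n//.
  by rewrite ler_pdivlMr ?ltr0n// mul1r ler_nat.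
Qed.

(** * Fractions with denominators in a block *)

Definition fracr (R : realType) (x : nat * nat) : R := x.1%:R / x.2%:R.

(** Coprimality makes distinct pairs distinct fractions. The denominators of one block agree up to
    the factor [M], so spacing and weight can be estimated at its ends. *)
Definition farey_block (M k : nat) : seq (nat * nat) :=
  [seq x <- [seq (p, q) | p <- iota 0 (M ^ k.+1).+1, q <- iota 0 (M ^ k.+1).+1]
  | [&& coprime x.1 x.2, (x.1 <= x.2)%N & (M ^ k < x.2 <= M ^ k.+1)%N]].

Lemma mem_farey_block M k x : (x \in farey_block M k) =
  [&& coprime x.1 x.2, (x.1 <= x.2)%N & (M ^ k < x.2 <= M ^ k.+1)%N].
Proof.
rewrite mem_filter andb_idr// => /and3P[_ x12 /andP[_ x2]].
case: x x12 x2 => p q pq qM.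
have pM : p \in iota 0 (M ^ k.+1).+1 by rewrite mem_iota ltnS (leq_trans pq).
have qM1 : q \in iota 0 (M ^ k.+1).+1 by rewrite mem_iota.
exact: (@allpairs_f nat nat _ pair).
Qed.

Lemma farey_block_uniq M k : uniq (farey_block M k).
Proof.
by rewrite filter_uniq// allpairs_uniq ?iota_uniq// => -[? ?] [? ?] _ _ /= [-> ->].
Qed.

(** The difference has denominator q q', and its numerator p q' - p' q is a non-zero integer, since
    by Gauss's lemma equal reduced fractions have equal entries. *)
Lemma fracr_sep (R : realType) (x y : nat * nat) :
  coprime x.1 x.2 -> coprime y.1 y.2 -> (0 < x.2)%N -> (0 < y.2)%N -> x != y ->
  (x.2%:R * y.2%:R)^-1 <= `|fracr R x - fracr R y|.
Proof.
case: x y => [p q] [p' q'] /= cpq cpq' q0 q'0 xy; rewrite /fracr/=.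
have q0R : 0 < q%:R :> R by rewrite ltr0n.
have q'0R : 0 < q'%:R :> R by rewrite ltr0n.
have -> : p%:R / q%:R - p'%:R / q'%:R =
    ((p%:Z * q'%:Z - p'%:Z * q%:Z)%:~R : R) * (q%:R * q'%:R)^-1.
  rewrite intrB !intrM -!pmulrn; field.
  by rewrite !gt_eqF.
have den0 : 0 < (q%:R * q'%:R)^-1 :> R by rewrite invr_gt0 mulr_gt0.
rewrite normrM (gtr0_norm den0) ler_peMl ?(ltW den0)//.
rewrite -intr_norm -[1]/(1%:~R) ler_int -gtz0_ge1 normr_gt0 subr_eq0.
apply: contra xy => /eqP [e].
have e' : (p * q' = p' * q)%N by lia.
have qq' : (q %| q')%N by rewrite -(@Gauss_dvdr _ p) 1?coprime_sym// e' dvdn_mull.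
have q'q : (q' %| q)%N by rewrite -(@Gauss_dvdr _ p') 1?coprime_sym// -e' dvdn_mull.
have qE : q = q' by apply/eqP; rewrite eqn_dvd qq' q'q.
subst q'; apply/eqP; congr (_, _).
by apply/eqP; rewrite -(eqn_pmul2r q0) e'.
Qed.

Lemma farey_block_sep (R : realType) (M j k : nat) (x y : nat * nat) :
  x \in farey_block M j -> y \in farey_block M k -> x != y ->
  (M%:R ^+ j.+1 * M%:R ^+ k.+1)^-1 <= `|fracr R x - fracr R y|.
Proof.
rewrite !mem_farey_block => /and3P[cx _ /andP[x0 xM]] /and3P[cy _ /andP[y0 yM]] xy.
have x2 : (0 < x.2)%N by exact: leq_ltn_trans x0.
have y2 : (0 < y.2)%N by exact: leq_ltn_trans y0.
apply: le_trans (fracr_sep R cx cy x2 y2 xy).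
rewrite lef_pV2 ?posrE ?mulr_gt0 ?ltr0n//.
  by rewrite -!natrX -!natrM ler_nat leq_mul.
by rewrite -natrX ltr0n (leq_trans x2).
by rewrite -natrX ltr0n (leq_trans y2).
Qed.

(** [h] will select the intervals [u i, v i] that meet [a, b]. The margin [sigma] leaves room for an
    interval of length psi(q) beside an admissible fraction. *)
Definition avoids (R : realType) (a b sigma : R) (u v : nat -> R) (n : nat)
    (h : pred nat) : pred R := fun y => (a + sigma <= y <= b - sigma) &&
  all (fun i => h i ==> (y <= u i - sigma) || (v i + sigma <= y)) (iota 0 n).

(** Each q <= M^k has q + 1 numerators and contributes 2(q + 1)/(q M^(k+1)) <= 4/M^(k+1). *)
Lemma sum_small_intervals (R : realType) (M k : nat) : (0 < M)%N ->
  \sum_(q <- iota 1 (M ^ k)) \sum_(p <- iota 0 q.+1)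
    2 * (q%:R * (M ^ k.+1)%:R)^-1 <= 4 / M%:R :> R.
Proof.
move=> M0; set Q := (M ^ k.+1)%N.
have Q0 : (0 < Q)%N by rewrite expn_gt0 M0.
apply: (@le_trans _ _ (\sum_(q <- iota 1 (M ^ k)) 4 / Q%:R)).
  rewrite big_seq [leRHS]big_seq; apply: ler_sum => q.
  rewrite mem_iota => /andP[q1 _].
  rewrite big_const_seq iter_addr_0 count_predT size_iota -[leLHS]mulr_natr.
  rewrite invfM.
  have q1R : 1 <= q%:R :> R by rewrite ler1n.
  have -> : 2 * (q%:R^-1 * Q%:R^-1) * q.+1%:R = Q%:R^-1 * (2 * (1 + q%:R^-1)) :> R.
    rewrite -natr1; field; rewrite !pnatr_eq0; lia.
  rewrite mulrC ler_wpM2r// ?invr_ge0//.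
  have : q%:R^-1 <= 1 :> R by rewrite invf_le1//; lra.
  lra.
rewrite big_const_seq iter_addr_0 count_predT size_iota -[leLHS]mulr_natr.
rewrite /Q expnS natrM invfM.
have Mk0 : (M ^ k)%:R != 0 :> R by rewrite pnatr_eq0 -lt0n expn_gt0 M0.
by rewrite mulrA mulfVK.
Qed.

Lemma sum_centered_intervals (R : realFieldType) (T : Type) (s : seq T)
    (c r : T -> R) :
  \sum_(I <- [seq (c x - r x, c x + r x) | x <- s]) (I.2 - I.1) =
  \sum_(x <- s) 2 * r x.
Proof. by rewrite big_map; apply: eq_bigr => x _ /=; lra. Qed.

(** Dirichlet's theorem with bound [Q]: a denominator above [q0] makes the error less than 1/(q0 Q)
    <= sigma, which costs at most half of the margin 2 sigma of [y]. *)
Lemma dirichlet_avoids (R : realType) (a b sigma : R) (q0 Q n : nat)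
    (u v : nat -> R) (h : pred nat) (y : R) :
  0 <= a -> b <= 1 -> a <= y <= b -> (0 < q0)%N -> (0 < Q)%N ->
  (q0%:R * Q%:R)^-1 <= sigma -> avoids a b (2 * sigma) u v n h y ->
  (exists p q : nat, [/\ (0 < q <= q0)%N, (p <= q)%N &
     `|y - fracr R (p, q)| < (q%:R * Q%:R)^-1]) \/
  (exists p q : nat, [/\ coprime p q, (p <= q)%N, (q0 < q <= Q)%N,
     `|y - fracr R (p, q)| < (q0%:R * Q%:R)^-1 &
     avoids a b sigma u v n h (fracr R (p, q))]).
Proof.
move=> a0 b1 /andP[ay yb] q00 Q0 q0s /andP[yab yuv].
have y01 : 0 <= y <= 1 by lra.
have [p [q [cpq /andP[q_gt0 qQ] pq ypq]]] := dirichlet_coprime Q0 y01.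
have [qq0|q0q] := leqP q q0; [left|right]; exists p, q; first by rewrite q_gt0.
have q0q' : (q%:R * Q%:R)^-1 <= (q0%:R * Q%:R)^-1 :> R.
  rewrite lef_pV2 ?posrE ?mulr_gt0 ?ltr0n//.
  by rewrite ler_pM2r ?ltr0n// ler_nat ltnW.
have yx : `|y - fracr R (p, q)| < (q0%:R * Q%:R)^-1 by exact: lt_le_trans q0q'.
split; rewrite ?q0q//.
have : `|y - fracr R (p, q)| < sigma by exact: lt_le_trans q0s.
rewrite ltr_norml => ys; rewrite /avoids; apply/andP; split; first by lra.
apply/allP => i /(allP yuv) /implyP H; apply/implyP => /H.
by move=> /orP[?|?]; apply/orP; [left|right]; lra.
Qed.

(** Four families of open intervals cover [a, b]: [E] around the ends, [F] around the forbidden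
    intervals, [S] around the fractions with denominator at most M^k and [L] around the admissible
    fractions of block k. Their total length is at least b - a. *)
Lemma avoids_count_ge (R : realType) (a b beta sigma : R) (M k n : nat)
    (u v : nat -> R) (h : pred nat) :
  0 <= a -> b <= 1 -> (0 < M)%N -> 0 < sigma ->
  (M%:R ^+ k * M%:R ^+ k.+1)^-1 <= sigma ->
  (forall i, u i <= v i) -> \sum_(0 <= i < n | h i) (v i - u i) <= beta ->
  b - a <= beta + 4 * sigma * (n%:R + 2) + 4 / M%:R +
    (size [seq x <- farey_block M k |
             avoids a b sigma u v n h (fracr R x)])%:R *
    (2 * (M%:R ^+ k * M%:R ^+ k.+1)^-1).
Proof.
move=> a0 b1 M0 s0 ks uv sumuv.
have Mk0 j : (0 < M ^ j)%N by rewrite expn_gt0 M0.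
set P := [seq x <- _ | _].
pose small := [seq (p, q) | q <- iota 1 (M ^ k), p <- iota 0 q.+1].
pose forb := [seq i <- iota 0 n | h i].
pose edges := [:: a; b].
pose E := [seq (x - 2 * sigma, x + 2 * sigma) | x <- edges].
pose F := [seq (u i - 2 * sigma, v i + 2 * sigma) | i <- forb].
pose rs (x : nat * nat) : R := (x.2%:R * (M ^ k.+1)%:R)^-1.
pose S := [seq (fracr R x - rs x, fracr R x + rs x) | x <- small].
pose rl (x : nat * nat) := ((M ^ k)%:R * (M ^ k.+1)%:R : R)^-1.
pose L := [seq (fracr R x - rl x, fracr R x + rl x) | x <- P].
have sE : \sum_(I <- E) (I.2 - I.1) = 8 * sigma.
  by rewrite /E sum_centered_intervals !big_cons big_nil; lra.
have sF : \sum_(I <- F) (I.2 - I.1) <= beta + 4 * sigma * n%:R.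
  rewrite big_map big_filter.
  have -> : \sum_(i <- iota 0 n | h i)
      ((u i - 2 * sigma, v i + 2 * sigma).2 - (u i - 2 * sigma, v i + 2 * sigma).1) =
     \sum_(0 <= i < n | h i) (v i - u i) + \sum_(0 <= i < n | h i) 4 * sigma.
    by rewrite -big_split/= /index_iota subn0; apply: eq_bigr => i _; lra.
  rewrite lerD// big_const_seq iter_addr_0 -[leLHS]mulr_natr ler_wpM2l//.
    by rewrite mulr_ge0// ltW.
  by rewrite ler_nat (leq_trans (count_size _ _))// size_iota subn0.
have sS : \sum_(I <- S) (I.2 - I.1) <= 4 / M%:R.
  rewrite /S sum_centered_intervals big_allpairs_dep/=.
  exact: sum_small_intervals.
have sL : \sum_(I <- L) (I.2 - I.1) =
    (size P)%:R * (2 * (M%:R ^+ k * M%:R ^+ k.+1)^-1).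
  rewrite /L sum_centered_intervals /rl big_const_seq iter_addr_0 count_predT.
  by rewrite -[LHS]mulr_natl !natrX.
suff : b - a <= \sum_(I <- E ++ F ++ S ++ L) (I.2 - I.1).
  by rewrite !big_cat; move: sE sF sS sL => /=; lra.
have rs0 x : 0 <= rs x by rewrite invr_ge0 mulr_ge0.
have rl0 x : 0 <= rl x by rewrite invr_ge0 mulr_ge0.
apply: open_cover_length => [I|y yab].
  rewrite !mem_cat => /or4P[] /mapP[x _ ->]; rewrite [X in X <= _]/= [leRHS]/=.
  - by lra.
  - by have := uv x; lra.
  - by have := rs0 x; lra.
  - by have := rl0 x; lra.
have [/hasP[x xe yx]|/hasPn yE] :=
    boolP (has (fun x => x - 2 * sigma < y < x + 2 * sigma) edges).
  exists (x - 2 * sigma, x + 2 * sigma) => //.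
  by rewrite mem_cat; apply/orP; left; apply/mapP; exists x.
have [/hasP[i iin iy]|/hasPn yF] :=
    boolP (has (fun i => u i - 2 * sigma < y < v i + 2 * sigma) forb).
  exists (u i - 2 * sigma, v i + 2 * sigma) => //.
  rewrite !mem_cat; apply/or4P; apply: Or42.
  by apply/mapP; exists i.
have yav : avoids a b (2 * sigma) u v n h y.
  apply/andP; split.
    have := yE a; rewrite mem_head => /(_ isT).
    have := yE b; rewrite inE mem_head orbT => /(_ isT).
    by rewrite !negb_and -!leNgt => ? ?; lra.
  apply/allP => i iin; apply/implyP => hi.
  have := yF i; rewrite mem_filter hi iin => /(_ isT).
  by rewrite negb_and -!leNgt.
have ks' : ((M ^ k)%:R * (M ^ k.+1)%:R)^-1 <= sigma by rewrite !natrX.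
have [[p [q [q0 pq ypq]]]|[p [q [cpq pq q0 ypq ypqa]]]] :=
    dirichlet_avoids a0 b1 yab (Mk0 k) (Mk0 k.+1) ks' yav.
  exists (fracr R (p, q) - rs (p, q), fracr R (p, q) + rs (p, q)).
    rewrite !mem_cat; apply/or4P; apply: Or43.
    apply/mapP; exists (p, q) => //.
    apply/allpairsPdep; exists q, p; split => //.
      by rewrite mem_iota add1n ltnS.
    by rewrite mem_iota ltnS.
  by move: ypq; rewrite /rs /= ltr_norml; lra.
exists (fracr R (p, q) - rl (p, q), fracr R (p, q) + rl (p, q)); last first.
  by move: ypq; rewrite /rl /= ltr_norml; lra.
rewrite !mem_cat; apply/or4P; apply: Or44.
apply/mapP; exists (p, q) => //.
by rewrite mem_filter ypqa mem_farey_block cpq pq q0.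
Qed.

Lemma farey_count (R : realType) (a b beta : R) (M n : nat) (u v : nat -> R)
    (h : pred nat) :
  0 <= a -> b <= 1 -> beta < b - a -> 16 <= M%:R * (b - a - beta) ->
  (forall i, u i <= v i) -> \sum_(0 <= i < n | h i) (v i - u i) <= beta ->
  exists2 sigma, 0 < sigma & exists k1, forall k, (k1 <= k)%N ->
    (b - a - beta) / 4 * (M%:R ^+ 2) ^+ k <=
    (size [seq x <- farey_block M k |
             avoids a b sigma u v n h (fracr R x)])%:R.
Proof.
move=> a0 b1 + gM uv sumuv; rewrite -subr_gt0 => g0; set g := b - a - beta in g0 gM *.
have M0 : (0 < M)%N by rewrite lt0n; apply: contraTneq gM => ->; rewrite -ltNge; lra.
have M0R : 0 < M%:R :> R by rewrite ltr0n.
have n20 : 0 < n%:R + 2 :> R by rewrite ltr_wpDl.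
(* The ends and the forbidden intervals then cost 4 sigma (n + 2) = g/4. As 4/M <= g/4, at least g/2
   is left to the admissible fractions. *)
pose sigma := g / 16 / (n%:R + 2).
have sE : sigma * (n%:R + 2) = g / 16 by rewrite /sigma divfK// gt_eqF.
have s0 : 0 < sigma by rewrite !divr_gt0.
exists sigma => //.
(* [beta] bounds a sum of non-negative terms, so g <= b - a <= 1. *)
have M16 : (16 <= M)%N.
  have : 0 <= \sum_(0 <= i < n | h i) (v i - u i).
    by apply: sumr_ge0 => i _; rewrite subr_ge0.
  move=> sum0; have g1 : 0 <= M%:R * (1 - g) by rewrite mulr_ge0 ?ler0n// /g; lra.
  by rewrite -(ler_nat R); lra.
(* From here on M^k >= k >= 1/sigma. *)
exists (Num.bound sigma^-1) => k kk.
have ks : (M%:R ^+ k * M%:R ^+ k.+1)^-1 <= sigma.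
  rewrite -[leRHS]invrK lef_pV2 ?posrE ?invr_gt0 ?mulr_gt0 ?exprn_gt0//.
  have : sigma^-1 <= k%:R.
    apply: le_trans (ltW (archi_boundP _)) _; first by rewrite invr_ge0 ltW.
    by rewrite ler_nat.
  move=> /le_trans; apply; rewrite -!natrX -natrM ler_nat.
  rewrite (leq_trans (ltnW (@ltn_expl M k _)))//; first exact: leq_trans M16.
  by rewrite leq_pmulr// expn_gt0 M0.
have := avoids_count_ge a0 b1 M0 s0 ks uv sumuv; rewrite -[_ * sigma * _]mulrA sE.
set N := (size _)%:R => H.
have A0 : 0 < (M%:R ^+ 2) ^+ k :> R by rewrite !exprn_gt0.
have M4 : 4 / M%:R <= g / 4 by rewrite ler_pdivrMr//; lra.
have AE : M%:R ^+ k * M%:R ^+ k.+1 = M%:R * (M%:R ^+ 2) ^+ k :> R.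
  by rewrite exprS mulrCA -exprM mulnC exprM expr2.
have {H} : g / 2 <= N * (2 * (M%:R ^+ k * M%:R ^+ k.+1)^-1).
  have gE : g = b - a - beta by [].
  by clearbody g; lra.
rewrite AE mulrA ler_pdivlMr ?mulr_gt0// => H.
have M2R : 1 <= M%:R :> R by rewrite ler1n.
have : g * (M%:R ^+ 2) ^+ k <= g * (M%:R * (M%:R ^+ 2) ^+ k).
  by rewrite ler_pM2l// ler_peMl// ltW.
by lra.
Qed.

(** * Thinning of the blocks *)

Lemma count_has_le (T U : Type) (s : seq U) (p : U -> pred T) (t : seq T) :
  (count (fun x => has (p^~ x) s) t <= \sum_(z <- s) count (p z) t)%N.
Proof.
elim: s => [|z s IHs]; first by rewrite big_nil (eq_count (a2 := pred0)) ?count_pred0.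
rewrite big_cons; have := count_predUI (p z) (fun x => has (p^~ x) s) t.
rewrite [count (predU _ _) t](_ : _ = count (fun x => has (p^~ x) (z :: s)) t)//.
by move: IHs => /= ? ?; lia.
Qed.

Lemma fracr_farey_block (R : realType) M k x : x \in farey_block M k ->
  0 <= fracr R x <= 1.
Proof.
rewrite mem_farey_block => /and3P[_ x12 /andP[x2 _]].
rewrite divr_ge0//= ler_pdivrMr ?mul1r ?ler_nat// ltr0n.
exact: leq_ltn_trans x2.
Qed.

(** The fractions of block k lie in [0, 1] at mutual distances at least 1/M^(2k+2), so there are at
    most M^(2k+2) + 1. *)
Lemma farey_block_size (R : realType) (M k : nat) : (0 < M)%N ->
  (size (farey_block M k))%:R <= 2 * (M%:R ^+ 2) ^+ k.+1 :> R.
Proof.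
move=> M0; have M1 : 1 <= M%:R :> R by rewrite ler1n.
have A0 : 0 < (M%:R ^+ 2) ^+ k.+1 :> R by rewrite !exprn_gt0// ltr0n.
have := @separated_size R _ (farey_block M k) (fracr R)
  ((M%:R ^+ 2) ^+ k.+1)^-1 0 1.
rewrite invr_gt0 A0 ler01 farey_block_uniq => /(_ isT isT isT).
move=> /(_ (fun x => @fracr_farey_block R M k x)) H.
have {}H : (size (farey_block M k))%:R * ((M%:R ^+ 2) ^+ k.+1)^-1 <=
    1 - 0 + ((M%:R ^+ 2) ^+ k.+1)^-1 :> R.
  apply: H => x y xk yk xy; rewrite -exprM mulnC exprM expr2.
  exact: farey_block_sep.
move: H; rewrite ler_pdivrMr// => /le_trans; apply.
rewrite subr0 mulrDl mul1r mulVf ?gt_eqF// mulr_natl mulr2n lerD2l.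
by rewrite -exprM exprn_ege1.
Qed.

(** Spacing gives the count 8 rho A + 1 with A = M^(2k+2). The 1 is absorbed: if any x of block k is
    counted, its distance to [y] is at least 1/A, whence 4 rho A >= 1. *)
Lemma near_farey_count (R : realType) (M j k : nat) (y : nat * nat) (rho : R) :
  (0 < M)%N -> (j < k)%N -> 0 <= rho -> y \in farey_block M j ->
  (count (fun x => `|fracr R x - fracr R y| < 4 * rho) (farey_block M k))%:R
    <= 12 * (M%:R ^+ 2) ^+ k.+1 * rho.
Proof.
move=> M0 jk rho0 yj; rewrite -size_filter; set P := [seq x <- _ | _].
have M1 : 1 <= M%:R :> R by rewrite ler1n.
have A0 : 0 < (M%:R ^+ 2) ^+ k.+1 :> R by rewrite !exprn_gt0// ltr0n.
have AE : (M%:R ^+ 2) ^+ k.+1 = M%:R ^+ k.+1 * M%:R ^+ k.+1 :> R.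
  by rewrite -exprM mulnC exprM expr2.
case E : P => [|x s].
  by rewrite !mulr_ge0// ltW.
have xP : x \in P by rewrite E mem_head.
rewrite -E.
move: xP; rewrite mem_filter => /andP[xy xk].
have xny : x != y.
  apply: contraTneq jk => xyE; move: yj xk; rewrite -leqNgt -xyE !mem_farey_block.
  move=> /and3P[_ _ /andP[_ xj]] /and3P[_ _ /andP[xk _]].
  rewrite leqNgt; apply/negP => jk.
  have : (M ^ j.+1 <= M ^ k)%N by rewrite leq_pexp2l.
  by rewrite leqNgt (leq_trans xk xj).
have Ar : 1 <= 4 * rho * (M%:R ^+ 2) ^+ k.+1.
  rewrite -ler_pdivrMr// mul1r ltW// (le_lt_trans _ xy)//.
  apply: le_trans (farey_block_sep R xk yj xny).
  have Mj : M%:R ^+ j.+1 <= M%:R ^+ k.+1 :> R by rewrite ler_weXn2l// ltnW.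
  have Mk0 i : 0 < M%:R ^+ i.+1 :> R by rewrite exprn_gt0// ltr0n.
  by rewrite AE lef_pV2 ?posrE ?mulr_gt0// ler_pM2l.
have := @separated_size R _ P (fracr R) ((M%:R ^+ 2) ^+ k.+1)^-1
  (fracr R y - 4 * rho) (fracr R y + 4 * rho).
rewrite invr_gt0 A0 filter_uniq ?farey_block_uniq// => H.
have {}H : (size P)%:R * ((M%:R ^+ 2) ^+ k.+1)^-1 <=
    fracr R y + 4 * rho - (fracr R y - 4 * rho) + ((M%:R ^+ 2) ^+ k.+1)^-1 :> R.
  apply: H => //; first by lra.
    by move=> z; rewrite mem_filter => /andP[+ _]; rewrite ltr_norml; lra.
  move=> z w; rewrite mem_filter => /andP[_ zk]; rewrite mem_filter => /andP[_ wk] zw.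
  by rewrite AE farey_block_sep.
move: H; rewrite ler_pdivrMr// mulrDl mulVf ?gt_eqF//.
by lra.
Qed.

(** Fractions near any candidate of an earlier block are dropped, even if that candidate was dropped
    itself. This avoids a recursion, and a union bound counts the loss. *)
Definition separated_level (R : realType) (P : nat -> seq (nat * nat))
    (rad : nat -> R) (k0 k : nat) : seq (nat * nat) :=
  [seq x <- P k | ~~ has (fun y => `|fracr R x - fracr R y.2| < 4 * rad y.1)
    [seq (j, y) | j <- index_iota k0 k, y <- P j]].

(** Block j has at most 2 A^(j+1) fractions, and each excludes at most 12 A^(k+1) rad j fractions of
    block k. *)
Lemma separated_level_size (R : realType) (M : nat) (G : pred R)
    (rad : nat -> R) (k0 k : nat) :
  let P := fun k => [seq x <- farey_block M k | G (fracr R x)] in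
  let A := M%:R ^+ 2 : R in
  (0 < M)%N -> (forall j, 0 <= rad j) ->
  (size (P k))%:R - 24 * A ^+ 2 * A ^+ k * \sum_(k0 <= j < k) A ^+ j * rad j <=
  (size (separated_level P rad k0 k))%:R.
Proof.
move=> P A M0 rad0.
rewrite /separated_level size_filter -(count_predC
  (fun x => has (fun y => `|fracr R x - fracr R y.2| < 4 * rad y.1)
    [seq (j, y) | j <- index_iota k0 k, y <- P j]) (P k)) natrD.
rewrite lerBlDr [leRHS]addrC lerD2r.
have A0 j : 0 < A ^+ j by rewrite !exprn_gt0// ltr0n.
apply: (@le_trans _ _ (\sum_(k0 <= j < k) \sum_(y <- P j)
    12 * A ^+ k.+1 * rad j)).
  have := count_has_le [seq (j, y) | j <- index_iota k0 k, y <- P j]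
    (fun y x => `|fracr R x - fracr R y.2| < 4 * rad y.1) (P k).
  rewrite -(ler_nat R) => /le_trans; apply.
  rewrite big_allpairs_dep/= natr_sum big_seq [leRHS]big_seq.
  apply: ler_sum => j; rewrite mem_index_iota => /andP[_ jk].
  rewrite natr_sum big_seq [leRHS]big_seq.
  apply: ler_sum => y; rewrite mem_filter => /andP[_ yj].
  apply: le_trans (near_farey_count M0 jk (rad0 j) yj).
  rewrite ler_nat /P count_filter.
  by apply: sub_count => x /= /andP[].
rewrite mulr_sumr; apply: ler_sum => j _.
rewrite big_const_seq iter_addr_0 count_predT -[leLHS]mulr_natl.
have sP : (size (P j))%:R <= 2 * A ^+ j.+1.
  apply: le_trans (farey_block_size R j M0).
  by rewrite ler_nat size_filter count_size.
have := @ler_wpM2r R (12 * A ^+ k.+1 * rad j) _ _ _ sP.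
have -> : 24 * A ^+ 2 * A ^+ k * (A ^+ j * rad j) =
  2 * A ^+ j.+1 * (12 * A ^+ k.+1 * rad j) by rewrite !exprS; ring.
by apply; rewrite !mulr_ge0// ltW.
Qed.

Lemma separated_levels_uniq (R : realType) (M : nat) (G : pred R)
    (rad : nat -> R) (k0 K : nat) :
  let P := fun k => [seq x <- farey_block M k | G (fracr R x)] in
  (0 < M)%N ->
  uniq [seq x | k <- index_iota k0 K, x <- separated_level P rad k0 k].
Proof.
move=> P M0.
apply: allpairs_uniq_dep; first exact: iota_uniq.
  by move=> k _; do 2 apply: filter_uniq; exact: farey_block_uniq.
move=> _ _ /allpairsPdep[j [x [_ xj ->]]] /allpairsPdep[k [y [_ yk ->]]] /= xy.
move: xj yk; rewrite mem_filter => /andP[_]; rewrite mem_filter => /andP[_].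
move=> + ; rewrite xy mem_farey_block => /and3P[_ _ /andP[jx xj]].
rewrite mem_filter => /andP[_]; rewrite mem_filter => /andP[_].
rewrite mem_farey_block => /and3P[_ _ /andP[ky yk]].
suff -> : j = k by [].
have aux i l : (M ^ i < y.2)%N -> (y.2 <= M ^ l.+1)%N -> (i <= l)%N.
  move=> iy yl; rewrite leqNgt; apply/negP => li.
  by have := leq_pexp2l M0 li; rewrite leqNgt (leq_trans iy yl).
by apply/eqP; rewrite eqn_leq (aux j k)// (aux k j).
Qed.

Lemma separated_levels_sep (R : realType) (M : nat) (G : pred R)
    (rad : nat -> R) (k0 j k : nat) (x y : nat * nat) :
  let P := fun k => [seq x <- farey_block M k | G (fracr R x)] in
  (forall i, (k0 <= i)%N -> 4 * rad i <= ((M%:R ^+ 2) ^+ i.+1)^-1) ->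
  (k0 <= j)%N -> (j <= k)%N ->
  x \in separated_level P rad k0 j -> y \in separated_level P rad k0 k ->
  x != y -> 4 * rad j <= `|fracr R x - fracr R y|.
Proof.
move=> P radi k0j; rewrite leq_eqVlt => /predU1P[<-|jk].
  rewrite mem_filter => /andP[_]; rewrite mem_filter => /andP[_ xj].
  rewrite mem_filter => /andP[_]; rewrite mem_filter => /andP[_ yj] xy.
  rewrite (le_trans (radi _ k0j))// (le_trans _ (farey_block_sep R xj yj xy))//.
  by rewrite -exprM mulnC exprM expr2.
rewrite mem_filter => /andP[_ xj]; rewrite mem_filter => /andP[/hasPn + _] _.
move=> /(_ (j, x)) /=; rewrite -leNgt distrC; apply.
apply/allpairsPdep; exists j, x; split => //.
by rewrite mem_index_iota k0j.
Qed.

(** * Separated fractions of large total weight *)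

Lemma avoids_le (R : realType) (a b s t : R) (u v : nat -> R) (n : nat)
    (h : pred nat) (y : R) : s <= t ->
  avoids a b t u v n h y -> avoids a b s u v n h y.
Proof.
move=> st /andP[yab /allP yuv]; rewrite /avoids; apply/andP; split; first by lra.
apply/allP => i /yuv /implyP H; apply/implyP => /H.
by move=> /orP[?|?]; apply/orP; [left|right]; lra.
Qed.

Lemma noninc_of_sqr (R : realType) (Psi : R -> R) (x y : R) :
  (forall x : R, 0 < x -> 0 < Psi x) ->
  (forall x y : R, 0 < x -> x <= y -> y ^+ 2 * Psi y <= x ^+ 2 * Psi x) ->
  0 < x -> x <= y -> Psi y <= Psi x.
Proof.
move=> Psi0 noninc x0 xy; have y0 : 0 < y by exact: lt_le_trans xy.
rewrite -(ler_pM2l (exprn_gt0 2 y0)) (le_trans (noninc _ _ x0 xy))//.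
by rewrite ler_pM2r ?Psi0// lerXn2r// nnegrE ltW.
Qed.

(** Cauchy condensation with base [M]: the block [M^K, M^(K+1)[ has at most M^(K+1) terms, each at
    most M^(K+1) Psi(M^K). *)
Lemma condensation (R : realType) (Psi : R -> R) (M k0 : nat) (C : R) :
  (forall x : R, 0 < x -> 0 < Psi x) ->
  (forall x y : R, 0 < x -> x <= y -> y ^+ 2 * Psi y <= x ^+ 2 * Psi x) ->
  (forall C : R, exists n, C <= \sum_(1 <= i < n) i%:R * Psi i%:R) ->
  (1 < M)%N ->
  exists K, C <= \sum_(k0 <= k < K) (M%:R ^+ 2) ^+ k * Psi (M%:R ^+ k).
Proof.
move=> Psi0 noninc div M1; pose F k : R := (M%:R ^+ 2) ^+ k * Psi (M%:R ^+ k).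
have M0R : 0 < M%:R :> R by rewrite ltr0n ltnW.
have F0 k : 0 <= F k by rewrite mulr_ge0 ?exprn_ge0// ltW ?Psi0 ?exprn_gt0.
have block K : \sum_(1 <= i < M ^ K) i%:R * Psi i%:R <=
    M%:R ^+ 2 * \sum_(0 <= k < K) F k.
  elim: K => [|K IHK]; first by rewrite !big_geq// mulr0.
  rewrite (@big_cat_nat _ _ _ (M ^ K))//=; last 2 first.
  - by rewrite expn_gt0 ltnW.
  - by rewrite leq_pexp2l// ltnW.
  rewrite big_nat_recr//= mulrDr lerD//.
  apply: (@le_trans _ _ (\sum_(M ^ K <= i < M ^ K.+1) M%:R ^+ K.+1 * Psi (M%:R ^+ K))).
    apply: ler_sum_nat => i /andP[Ki iK].
    have i0 : 0 < i%:R :> R by rewrite ltr0n (leq_trans _ Ki)// expn_gt0 ltnW.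
    apply: ler_pM => //; first by rewrite ltW ?Psi0.
      by rewrite -natrX ler_nat ltnW.
    by apply: noninc_of_sqr => //; rewrite ?exprn_gt0// -natrX ler_nat.
  rewrite sumr_const_nat -[leLHS]mulr_natl.
  have -> : M%:R ^+ 2 * F K = M%:R ^+ K.+1 * (M%:R ^+ K.+1 * Psi (M%:R ^+ K)).
    by rewrite /F -exprM mulnC exprM !exprS; ring.
  rewrite ler_wpM2r//; last by rewrite -natrX ler_nat leq_subr.
  by rewrite mulr_ge0 ?exprn_ge0// ltW ?Psi0 ?exprn_gt0.
have A0 : 0 < M%:R ^+ 2 :> R by rewrite exprn_gt0.
(* The demand includes the factor M^2 of the block estimate and the terms below [k0], which are
   discarded afterwards. *)
have [n Cn] := div (M%:R ^+ 2 * (C + \sum_(0 <= k < k0) F k)).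
exists (maxn n k0); rewrite -(ler_pM2l A0).
suff : M%:R ^+ 2 * (C + \sum_(0 <= k < k0) F k) <=
    M%:R ^+ 2 * \sum_(0 <= k < maxn n k0) F k.
  rewrite (@big_cat_nat _ _ _ k0 0 (maxn n k0)) ?leq_maxr//= !mulrDr.
  by rewrite addrC lerD2l.
apply: (le_trans Cn); apply: le_trans (block _).
have [n1|n1] := leqP n 1.
  rewrite big_geq// big_nat sumr_ge0// => i /andP[i1 _].
  by rewrite mulr_ge0// ltW// Psi0// ltr0n.
rewrite [leRHS](@big_cat_nat _ _ _ n)//=; last 2 first.
- exact: ltnW.
- by rewrite (leq_trans (leq_maxl n k0))// ltnW// ltn_expl.
rewrite lerDl big_nat sumr_ge0// => i /andP[ni _].
by rewrite mulr_ge0// ltW// Psi0// ltr0n (leq_trans _ ni)// ltnW.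
Qed.

(** [m0] depends only on [a], [b] and [beta] and is fixed before [n], so that [n] can later be
    chosen to make the tail of the s-sum small compared with [m0]. *)
Lemma selection (R : realType) (Psi : R -> R) (a b beta : R) :
  (forall x : R, 0 < x -> 0 < Psi x) ->
  (forall x y : R, 0 < x -> x <= y -> y ^+ 2 * Psi y <= x ^+ 2 * Psi x) ->
  (forall e : R, 0 < e ->
     exists N : nat, forall n, (N <= n)%N -> n%:R ^+ 2 * Psi n%:R <= e) ->
  (forall C : R, exists n, C <= \sum_(1 <= i < n) i%:R * Psi i%:R) ->
  0 <= a -> b <= 1 -> beta < b - a ->
  exists2 m0, 0 < m0 & forall (N n : nat) (u v : nat -> R) (h : pred nat),
    (forall i, u i <= v i) -> \sum_(0 <= i < n | h i) (v i - u i) <= beta ->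
    exists S : seq (nat * nat), [/\ uniq S,
      {in S, forall x, (N < x.2)%N /\
        avoids a b (Psi x.2%:R) u v n h (fracr R x)},
      {in S &, forall x y, x != y ->
        4 * Psi x.2%:R <= `|fracr R x - fracr R y|} &
      m0 <= \sum_(x <- S) Psi x.2%:R].
Proof.
move=> Psi0 noninc small div a0 b1 betaab.
pose g := b - a - beta; have g0 : 0 < g by rewrite subr_gt0.
pose M := (Num.bound (16 / g)).+2.
have M1 : (1 < M)%N by [].
have M0 : (0 < M)%N by [].
have gM : 16 <= M%:R * g.
  rewrite -ler_pdivrMr//.
  apply: (le_trans (ltW (archi_boundP _))); first by rewrite divr_ge0 ?ltW.
  by rewrite ler_nat /M leqW.
have M0R : 0 < M%:R :> R by [].
have M1R : 1 <= M%:R :> R by rewrite ler1n.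
clearbody M.
pose A : R := M%:R ^+ 2; have A0 : 0 < A by rewrite exprn_gt0.
have Ak0 k : 0 < A ^+ k by rewrite exprn_gt0.
have Ak1 k : 1 <= A ^+ k by rewrite exprn_ege1// exprn_ege1.
(* With this [tau] the thinning removes at most g/8 A^k of the at least g/4 A^k admissible fractions
   of block k. *)
pose tau := g / 4 / (48 * A ^+ 2).
have tau0 : 0 < tau by rewrite !divr_gt0// mulr_gt0// exprn_gt0.
have tauE : 24 * A ^+ 2 * tau = g / 8 by rewrite /tau; field; exact: lt0r_neq0.
have m0_gt0 : 0 < g / 8 / A * (tau / 2).
  by apply: mulr_gt0; [apply: divr_gt0 => //; lra|lra].
exists (g / 8 / A * (tau / 2)) => //.
move=> N n u v h uv sumuv.
have [sigma sigma0 [k1 count_k]] := farey_count a0 b1 betaab gM uv sumuv.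
(* tau/4 keeps the first level light, A^-1/4 makes 4 rad k at most the spacing of block k, and
   [sigma] is the margin of the admissible fractions. *)
pose e := Num.min (tau / 4) (Num.min (A^-1 / 4) sigma).
have Ai0 : 0 < A^-1 by rewrite invr_gt0.
have e0 : 0 < e by rewrite /e !lt_min; apply/and3P; split=> //; lra.
have [N1 smallN1] := small _ e0.
pose k0 := maxn k1 (maxn N N1).
pose rad k := Psi (M%:R ^+ k).
have rad0 k : 0 < rad k by rewrite Psi0// exprn_gt0.
pose F k := A ^+ k * rad k.
have F0 k : 0 <= F k by rewrite mulr_ge0 ?ltW.
have Fe k : (k0 <= k)%N -> F k <= e.
  move=> kk; rewrite /F /A -exprM mulnC exprM /rad -natrX; apply: smallN1.
  rewrite (leq_trans _ (ltnW (ltn_expl k M1)))// (leq_trans _ kk)//.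
  by rewrite /k0 !leq_max leqnn !orbT.
have radF k : rad k <= F k by rewrite ler_peMl// ltW.
have rad_noninc j k : (j <= k)%N -> rad k <= rad j.
  move=> jk; apply: noninc_of_sqr => //; first by rewrite exprn_gt0.
  by rewrite ler_weXn2l.
(* The sum starts at k0 + 1 because a fraction of block k has weight at least rad (k + 1). *)
pose T K := \sum_(k0.+1 <= k < K) F k.
have exT : exists K, tau / 2 <= T K.
  have [K TK] := @condensation R Psi M k0.+1 (tau / 2) Psi0 noninc div M1.
  by exists K.
(* By minimality only the last term carries the sum to tau/2, so the sum of [F] over the levels used
   stays at most tau. *)
have [K TK minK] := ex_minnP exT.
have TltK L : (L < K)%N -> T L < tau / 2.
  by move=> LK; rewrite ltNge; apply/negP => /minK; rewrite leqNgt LK.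
have : (k0.+1 < K)%N.
  rewrite ltnNge; apply/negP => Kk0; move: TK; rewrite /T big_geq//; lra.
case: K TK TltK {minK} => // K TK TltK; rewrite ltnS => k0K.
have sumF k : (k <= K)%N -> \sum_(k0 <= j < k) F j <= tau.
  move=> kK; apply: (@le_trans _ _ (\sum_(k0 <= j < K) F j)).
    have [kk0|k0k] := leqP k k0.
      by rewrite big_geq// sumr_ge0.
    rewrite [leRHS](@big_cat_nat _ _ _ k)//=; last exact: ltnW.
    by rewrite lerDl sumr_ge0.
  rewrite big_ltn//; have := TltK K (ltnSn _); have := Fe k0 (leqnn _).
  by rewrite /T /e le_min => /andP[? _] ?; lra.
pose G := avoids a b sigma u v n h.
pose P k := [seq x <- farey_block M k | G (fracr R x)].
have sepsize k : (k0 <= k < K)%N ->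
    g / 8 * A ^+ k <= (size (separated_level P rad k0 k))%:R.
  move=> /andP[k0k kK].
  have := @separated_level_size R M G rad k0 k M0 (fun j => ltW (rad0 j)).
  apply: le_trans.
  have /count_k : (k1 <= k)%N by apply: leq_trans k0k; rewrite /k0 leq_max leqnn.
  rewrite -/g -/A -/G -/(P k) => cP.
  have : 24 * A ^+ 2 * A ^+ k * \sum_(k0 <= j < k) A ^+ j * rad j <=
      24 * A ^+ 2 * A ^+ k * tau.
    by rewrite ler_wpM2l ?sumF ?(ltnW kK)// !mulr_ge0 ?ltW// exprn_gt0.
  have -> : 24 * A ^+ 2 * A ^+ k * tau = g / 8 * A ^+ k by rewrite -tauE; ring.
  by lra.
have levelP k x : x \in separated_level P rad k0 k ->
    [/\ x \in farey_block M k, G (fracr R x), (M ^ k < x.2)%N,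
        Psi x.2%:R <= rad k & rad k.+1 <= Psi x.2%:R].
  rewrite mem_filter => /andP[_]; rewrite mem_filter => /andP[Gx xk].
  have := xk; rewrite {1}mem_farey_block => /and3P[_ _ /andP[kx xk1]].
  have x0 : 0 < x.2%:R :> R by rewrite ltr0n (leq_ltn_trans _ kx).
  split => //; apply: noninc_of_sqr => //; rewrite ?exprn_gt0//.
    by rewrite -natrX ler_nat ltnW.
  by rewrite -natrX ler_nat.
exists [seq x | k <- index_iota k0 K, x <- separated_level P rad k0 k]; split.
- exact: separated_levels_uniq.
- move=> _ /allpairsPdep[k [x [kk /levelP[xk Gx kx xrad _] ->]]].
  move: kk; rewrite mem_index_iota => /andP[k0k kK]; split.
    apply: leq_ltn_trans kx; rewrite (leq_trans _ (ltnW (ltn_expl k M1)))//.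
    by rewrite (leq_trans _ k0k)// /k0 !leq_max leqnn !orbT.
  apply: avoids_le Gx; apply: (le_trans xrad); apply: (le_trans (radF _)).
  by have := Fe _ k0k; rewrite /e !le_min => /and3P[].
- have radi i : (k0 <= i)%N -> 4 * rad i <= (A ^+ i.+1)^-1.
    move=> /Fe; rewrite /e !le_min => /and3P[_ Fi _].
    rewrite -[leRHS]mul1r ler_pdivlMr// exprS.
    move: Fi; rewrite ler_pdivlMr// -[leRHS]mul1r ler_pdivlMr//.
    by rewrite /F; lra.
  move=> _ _ /allpairsPdep[j [x [jj xj ->]]] /allpairsPdep[k [y [kk yk ->]]] xy.
  move: jj kk; rewrite !mem_index_iota => /andP[k0j _] /andP[k0k _].
  have [_ _ _ xrad _] := levelP _ _ xj.
  have [jk|kj] := leqP j k.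
    have := separated_levels_sep radi k0j jk xj yk xy; lra.
  (* Now x lies in the later block and has the smaller radius, so the distance kept from the earlier
     block is enough. *)
  rewrite eq_sym in xy.
  have := separated_levels_sep radi k0k (ltnW kj) yk xj xy.
  by rewrite distrC; have := rad_noninc _ _ (ltnW kj); lra.
- rewrite big_allpairs_dep/=.
  apply: (@le_trans _ _ (\sum_(k0 <= k < K) g / 8 / A * F k.+1)).
    rewrite -mulr_sumr; apply: ler_wpM2l.
      by apply: divr_ge0; lra.
    by move: TK; rewrite /T big_add1.
  apply: ler_sum_nat => k kK.
  apply: (@le_trans _ _ (\sum_(x <- separated_level P rad k0 k) rad k.+1)).
    rewrite big_const_seq iter_addr_0 count_predT -[leRHS]mulr_natl.
    have -> : g / 8 / A * F k.+1 = g / 8 * A ^+ k * rad k.+1.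
      by rewrite /F exprS; field; rewrite gt_eqF.
    by rewrite ler_wpM2r ?sepsize// ltW.
  rewrite big_seq [leRHS]big_seq; apply: ler_sum => x /levelP[].
  by [].
Qed.

(** * Nested intervals *)

Lemma le_powR (R : realType) (x s : R) :
  0 <= x -> x <= 1 -> 0 < s -> s <= 1 -> x <= x `^ s.
Proof.
rewrite le_eqVlt => /predU1P[<- *|x0 x1 s0 s1]; first exact: powR_ge0.
by apply: ger1_powR; rewrite ?x0.
Qed.

Lemma powR_cancel_le (R : realType) (x y s : R) :
  0 <= x -> 0 <= y -> 0 < s -> x `^ s <= y `^ s -> x <= y.
Proof.
move=> x0 y0 s0; apply: contraTT; rewrite -!ltNge => yx.
by apply: gt0_ltr_powR => //; rewrite nnegrE.
Qed.

(* If [u, v] meets at least two of the [c x, c x + r x], its length is at least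
   the sum of the corresponding [r x]. *)
Lemma sum_hit_le (R : realType) (T : eqType) (S : seq T) (c r : T -> R)
    (u v s : R) :
  0 < s -> s <= 1 -> u <= v -> v <= u + 1 -> uniq S ->
  {in S, forall x, 0 < r x} ->
  {in S &, forall x y, x != y -> 4 * r x <= `|c x - c y|} ->
  \sum_(x <- S | (c x <= v) && (u <= c x + r x)) Num.min ((v - u) `^ s) (r x)
    <= (v - u) `^ s.
Proof.
move=> s0 s1 uv vu1 uS r0 sep; rewrite -big_filter.
set H := [seq x <- S | _].
have HS x : x \in H -> [/\ x \in S, c x <= v & u <= c x + r x].
  by rewrite mem_filter => /andP[/andP[]].
have uH : uniq H by rewrite filter_uniq.
case E : H => [|x t]; first by rewrite big_nil powR_ge0.
case: t => [|y t] in E *; first by rewrite big_seq1 ge_min lexx.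
have xH : x \in H by rewrite E mem_head.
have yH : y \in H by rewrite E inE mem_head orbT.
have xy : x != y.
  by move: uH; rewrite E /= inE negb_or => /andP[/andP[]].
(* Two hit centres are at distance at most v - u plus the radius of the left one, and at least four
   times either radius. *)
have close z w : z \in H -> w \in H -> z != w -> r z <= (v - u) / 2.
  move=> /HS[zS zv uz] /HS[wS wv uw] zw.
  have := sep z w zS wS zw; have := sep w z wS zS; rewrite eq_sym => /(_ zw).
  have := r0 z zS; have := r0 w wS; rewrite distrC.
  by have [czw|czw] := leP (c z) (c w); [rewrite ler0_norm|rewrite gtr0_norm]; lra.
have far z : z \in H -> r z <= (v - u) / 2.
  move=> zH; have [zx|zx] := eqVneq z x; last exact: close zx.
  by rewrite zx; exact: close xy.
rewrite -E; apply: (@le_trans _ _ (\sum_(z <- H) r z)).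
  by apply: ler_sum => z _; rewrite ge_min lexx orbT.
apply: (@le_trans _ _ (v - u)); last by apply: le_powR => //; lra.
(* The intervals of radius 2 r still have disjoint interiors and lie in an interval of length 7/2 (v
   - u), so four times the sum of the r is at most that. *)
have := @packing_length R T H c (fun x => 2 * r x) (u - 3 / 2 * (v - u)) (v + (v - u)).
rewrite uH => P.
have {}P : \sum_(z <- H) 2 * (2 * r z) <= v + (v - u) - (u - 3 / 2 * (v - u)).
  apply: P => //; first by lra.
    by move=> z zH; have [_ ? ?] := HS z zH; have := far z zH; split; lra.
  move=> z w /HS[zS _ _] /HS[wS _ _] zw.
  have := sep z w zS wS zw; have := sep w z wS zS; rewrite eq_sym => /(_ zw).
  by rewrite distrC; lra.
rewrite -mulr_sumr -mulr_sumr in P; lra.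
Qed.

(** Double counting: if every x were overloaded, the weights truncated at [r x] would still give it
    kappa (r x), hence kappa m0 > eta in all. But by [sum_hit_le] each interval contributes at most
    its own weight; the truncation keeps a long interval from counting fully at many centres. *)
Lemma exists_light_center (R : realType) (T : eqType) (S : seq T) (c r : T -> R)
    (u v : nat -> R) (s kappa eta m0 : R) (n : nat) :
  0 < s -> s <= 1 -> (forall i, u i <= v i) -> (forall i, v i <= u i + 1) ->
  uniq S -> {in S, forall x, 0 < r x} ->
  {in S &, forall x y, x != y -> 4 * r x <= `|c x - c y|} ->
  m0 <= \sum_(x <- S) r x ->
  0 < kappa -> kappa <= 1 -> eta < kappa * m0 ->
  (forall m, \sum_(n <= i < m) (v i - u i) `^ s <= eta) ->
  exists2 x, x \in S & forall m,
    \sum_(n <= i < m | (c x <= v i) && (u i <= c x + r x)) (v i - u i) `^ s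
      <= kappa * r x.
Proof.
move=> s0 s1 uv vu1 uS r0 sep rS k0 k1 eta_lt tail.
pose w i := (v i - u i) `^ s.
pose hit x i := (c x <= v i) && (u i <= c x + r x).
have w0 i : 0 <= w i by exact: powR_ge0.
apply: contrapT => /forall2NP no.
have [m big_m] : exists m, {in S, forall x,
    kappa * r x < \sum_(n <= i < m | hit x i) w i}.
  have : forall x, exists m, x \in S -> kappa * r x < \sum_(n <= i < m | hit x i) w i.
    move=> x; have [xS|xS] := boolP (x \in S); last by exists 0%N.
    have [//|/existsNP[m /negP]] := no x.
    by rewrite -ltNge => ?; exists m.
  move=> /choice[m mP]; exists (\max_(x <- S) m x) => x xS.
  apply: (lt_le_trans (mP x xS)).
  have mx : (m x <= \max_(x <- S) m x)%N by exact: leq_bigmax_seq.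
  have [nm|mn] := leqP n (m x).
    by rewrite [leRHS](@big_cat_nat _ _ _ (m x))//= lerDl sumr_ge0.
  by rewrite big_geq ?sumr_ge0// ltnW.
(* A single weight above [r x] already provides r x >= kappa (r x); if there is none, truncation
   changes nothing. *)
have big_min x : x \in S ->
    kappa * r x <= \sum_(n <= i < m | hit x i) Num.min (w i) (r x).
  move=> xS; have rx := r0 x xS.
  have [|/hasPn small] := boolP (has (fun i => hit x i && (r x < w i)) (index_iota n m)).
    move=> /hasP[i im /andP[hi riw]].
    rewrite (big_rem i)//= hi (min_r (ltW riw)).
    apply: (@le_trans _ _ (r x)); first by rewrite ler_piMl// ltW.
    rewrite lerDl sumr_ge0// => j _.
    by rewrite le_min w0 ltW.
  apply: (le_trans (ltW (big_m x xS))).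
  rewrite big_seq_cond [leRHS]big_seq_cond; apply: ler_sum => i /andP[im hi].
  by rewrite le_min lexx/= leNgt; have := small i im; rewrite hi.
have := eta_lt; apply/negP; rewrite -leNgt.
apply: (@le_trans _ _ (\sum_(x <- S) \sum_(n <= i < m | hit x i) Num.min (w i) (r x))).
  apply: (@le_trans _ _ (kappa * \sum_(x <- S) r x)); first by rewrite ler_pM2l.
  by rewrite mulr_sumr big_seq [leRHS]big_seq ler_sum.
apply: le_trans (tail m).
under eq_bigr do rewrite big_mkcond.
rewrite exchange_big/=; apply: ler_sum => i _; rewrite -big_mkcond/=.
exact: sum_hit_le.
Qed.

(** A uniform bound on the partial sums stands for the infinite sum; the gap b - a - beta bounds the
    uncovered length from below. *)
Definition light (R : realType) (u v : nat -> R) (a b : R) : Prop :=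
  exists2 beta, beta < b - a & forall m,
    \sum_(0 <= i < m | (a <= v i) && (u i <= b)) (v i - u i) <= beta.

(** Each d i is at most D, so d i = (d i)^s (d i)^(1-s) <= (d i)^s D^(1-s). *)
Lemma powR_load (R : realType) (I : eqType) (r : seq I) (P : pred I) (d : I -> R)
    (D s : R) : 0 < s -> s <= 1 -> 0 <= D -> (forall i, 0 <= d i) ->
  \sum_(i <- r | P i) d i `^ s <= D `^ s -> \sum_(i <- r | P i) d i <= D.
Proof.
move=> s0 s1 D0 d0 load.
have dD i : i \in r -> P i -> d i <= D.
  move=> ir Pi; apply: (powR_cancel_le (s := s)) => //.
  apply: le_trans load; rewrite (big_rem i)//= Pi lerDl sumr_ge0// => j _.
  exact: powR_ge0.
have -> : D = D `^ s * D `^ (1 - s).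
  by rewrite -powRD addrC subrK ?powRr1 ?oner_eq0.
apply: (@le_trans _ _ (\sum_(i <- r | P i) d i `^ s * D `^ (1 - s))).
  rewrite big_seq_cond [leRHS]big_seq_cond; apply: ler_sum => i /andP[ir Pi].
  have {1}-> : d i = d i `^ s * d i `^ (1 - s).
    by rewrite -powRD addrC subrK ?powRr1 ?oner_eq0.
  rewrite ler_wpM2l ?powR_ge0// ge0_ler_powR ?nnegrE//; first by lra.
  exact: dD.
by rewrite -mulr_suml ler_wpM2r ?powR_ge0.
Qed.

(** One step of the nesting. [N] bounds the denominator from below and counts the intervals to be
    missed, so that repetition with growing [N] yields infinitely many fractions and escapes every
    [u i, v i]. *)
Lemma exists_light_subinterval (R : realType) (psi : R -> R) (s : R) (u v : nat -> R)
    (a b eps : R) (N : nat) :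
  (forall x : R, 0 < x -> 0 < psi x) -> 0 < s -> s <= 1 ->
  (forall x y : R, 0 < x -> x <= y ->
     y ^+ 2 * psi y `^ s <= x ^+ 2 * psi x `^ s) ->
  (forall e : R, 0 < e ->
     exists N : nat, forall n, (N <= n)%N -> n%:R ^+ 2 * psi n%:R `^ s <= e) ->
  (forall C : R, exists n, C <= \sum_(1 <= i < n) i%:R * psi i%:R `^ s) ->
  (forall i, u i <= v i) -> (forall i, v i <= u i + 1) ->
  (forall eta, 0 < eta ->
     exists n, forall m, \sum_(n <= i < m) (v i - u i) `^ s <= eta) ->
  0 <= a -> b <= 1 -> light u v a b -> 0 < eps -> eps < 1 ->
  exists p q a' b', [/\ (N < q)%N, a <= a' <= b' /\ b' <= b, light u v a' b',
    forall y, a' <= y <= b' ->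
      (1 - eps) * psi q%:R < `|y - p%:R / q%:R| < psi q%:R &
    forall i, (i < N)%N -> forall y, a' <= y <= b' -> ~~ (u i <= y <= v i)].
Proof.
move=> psi0 s0 s1 noninc small div uv vu1 tail a0 b1 [beta beta_ab load] e0 e1.
pose Psi x := psi x `^ s.
have Psi0 x : 0 < x -> 0 < Psi x by move=> x0; rewrite powR_gt0// psi0.
have [m0 m00 sel] := selection Psi0 noninc small div a0 b1 beta_ab.
(* A load kappa psi(q)^s = (eps/8 psi(q))^s means total length at most eps/8 psi(q), half the length
   of the next interval. *)
pose kappa := (eps / 8) `^ s.
have k0 : 0 < kappa by rewrite powR_gt0//; lra.
have k1 : kappa <= 1.
  apply: (@le_trans _ _ (1 `^ s)); last by rewrite powR1.
  by apply: ge0_ler_powR; rewrite ?nnegrE; lra.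
have eta0 : 0 < kappa * m0 / 2 by rewrite divr_gt0// mulr_gt0.
have [n1 tail1] := tail _ eta0.
pose n := maxn N n1.
have tailn m : \sum_(n <= i < m) (v i - u i) `^ s <= kappa * m0 / 2.
  have [mn|nm] := leqP m n.
    by rewrite big_geq//; apply/ltW.
  apply: le_trans (tail1 m); rewrite [leRHS](@big_cat_nat _ _ _ n)//=; last 2 first.
  - exact: leq_maxr.
  - exact: ltnW.
  by rewrite lerDr sumr_ge0// => i _; exact: powR_ge0.
(* Beyond [N1], psi(q) <= 1 and so psi(q) <= psi(q)^s: [c, c + psi(q)] stays within the margin of
   the fraction c. *)
have [N1 small1] := small 1 ltr01.
pose h i := (a <= v i) && (u i <= b).
have [S [uS SP sep mS]] := sel (maxn N N1) n u v h uv (load n).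
have r0 : {in S, forall x, 0 < Psi x.2%:R}.
  by move=> x /SP[Nx _]; rewrite Psi0// ltr0n (leq_ltn_trans _ Nx).
have eta_lt : kappa * m0 / 2 < kappa * m0.
  by rewrite ltr_pdivrMr// mulr_natr mulr2n ltrDl mulr_gt0.
have [x xS loadx] := @exists_light_center R _ S (fracr R) (fun x => Psi x.2%:R)
  u v s kappa _ m0 n s0 s1 uv vu1 uS r0 sep mS k0 k1 eta_lt tailn.
have [Nx /andP[xab /allP xuv]] := SP x xS.
move: Nx; rewrite gtn_max => /andP[Nx N1x].
set c := fracr R x in xab xuv loadx *; pose q := x.2.
have q0 : 0 < q%:R :> R by rewrite ltr0n (leq_ltn_trans _ Nx).
have q1 : 1 <= q%:R :> R by rewrite ler1n (leq_ltn_trans _ Nx).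
pose f := psi q%:R; have f0 : 0 < f by exact: psi0.
have f1 : f <= 1.
  apply: (@powR_cancel_le _ _ _ s) => //; first exact: ltW.
  rewrite powR1; apply: le_trans (small1 _ (ltnW N1x)).
  by rewrite ler_peMl ?powR_ge0// exprn_ege1.
have fPsi : f <= Psi q%:R by apply: le_powR => //; exact: ltW.
have ef0 : 0 < eps * f by rewrite mulr_gt0.
have ef1 : eps * f < f by rewrite gtr_pMl.
exists x.1, q, (c + f - eps * f / 2), (c + f - eps * f / 4).
(* Forbidden intervals that meet [a, b] are avoided with margin psi(q)^s; the others miss [a, b],
   which contains the new interval. *)
have nohit i : (i < n)%N ->
    ~~ ((c + f - eps * f / 2 <= v i) && (u i <= c + f - eps * f / 4)).
  move=> ni; apply/negP => /andP[av ub].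
  have hi : h i by apply/andP; split; rewrite -/q in xab; lra.
  have := xuv i; rewrite mem_iota ni hi => /(_ isT) /orP[]; rewrite -/q; lra.
split => //.
- by move: xab; rewrite -/q; lra.
- exists (eps / 8 * f); first by lra.
  move=> m; apply: (@powR_load _ _ _ _ _ _ s) => //.
  - by apply: mulr_ge0; lra.
  - by move=> i; rewrite subr_ge0.
  rewrite powRM ?(ltW f0)//; last by lra.
  apply: (le_trans _ (loadx m)).
  have [mn|nm] := leqP m n.
    by rewrite big_nat_cond big_pred0 ?sumr_ge0// => [i _|i]; [exact: powR_ge0|];
      apply/negbTE/negP => /andP[/andP[_ im]]; apply/negP/nohit/(leq_trans im).
  rewrite (@big_cat_nat _ _ _ n)//=; last exact: ltnW.
  rewrite [X in X + _]big_nat_cond [X in X + _]big_pred0 ?add0r; last first.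
    by move=> i; apply/negbTE/negP => /andP[/andP[_ im]]; apply/negP/nohit.
  rewrite big_mkcond [leRHS]big_mkcond/=; apply: ler_sum => i _.
  case: ifP => [/andP[av ub]|_]; last by case: ifP => // _; exact: powR_ge0.
  rewrite ifT//; apply/andP; split; lra.
- move=> y ycd; rewrite -/f.
  rewrite ger0_norm; last by rewrite /c /fracr -/q in ycd; lra.
  by rewrite /c /fracr -/q in ycd; lra.
- move=> i iN y ycd; apply/negP => /andP[uy yv].
  have ni : (i < n)%N by rewrite (leq_trans iN)// leq_maxl.
  have := nohit i ni; rewrite negb_and -!ltNge => /orP[]; lra.
Qed.

Lemma nested_point (R : realType) (a b : nat -> R) :
  (forall n, a n <= a n.+1) -> (forall n, b n.+1 <= b n) ->
  (forall n, a n <= b n) -> exists x, forall n, a n <= x <= b n.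
Proof.
move=> aS bS ab.
have a_le := homo_leq (@lexx _ R) (@le_trans _ R) aS.
have b_le := homo_leq (r := fun x y => y <= x) (@lexx _ R)
  (fun x y z xy yz => le_trans yz xy) bS.
have amb m n : a m <= b n.
  apply: le_trans (b_le _ _ (leq_maxr m n)).
  exact: le_trans (a_le _ _ (leq_maxl m n)) (ab _).
have A0 : range a !=set0 by exists (a 0%N), 0%N.
exists (sup (range a)) => n; apply/andP; split.
  by apply: ub_le_sup; [exists (b 0%N) => _ [m _ <-]|exists n].
by apply: ge_sup => // _ [m _ <-].
Qed.

Lemma infinite_unbounded (T : choiceType) (A : set (T * nat)) :
  (forall n, exists x, A x /\ (n < x.2)%N) -> infinite_set A.
Proof.
move=> unb /finite_seqP[s As].
have [x [Ax]] := unb (\max_(y <- s) y.2)%N.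
apply/negP; rewrite -leqNgt; apply: leq_bigmax_seq => //.
by move: Ax; rewrite As.
Qed.

Lemma exact_point (R : realType) (psi : R -> R) (s : R) (u v : nat -> R)
    (a b : R) :
  (forall x : R, 0 < x -> 0 < psi x) -> 0 < s -> s <= 1 ->
  (forall x y : R, 0 < x -> x <= y ->
     y ^+ 2 * psi y `^ s <= x ^+ 2 * psi x `^ s) ->
  (forall e : R, 0 < e ->
     exists N : nat, forall n, (N <= n)%N -> n%:R ^+ 2 * psi n%:R `^ s <= e) ->
  (forall C : R, exists n, C <= \sum_(1 <= i < n) i%:R * psi i%:R `^ s) ->
  (forall i, u i <= v i) -> (forall i, v i <= u i + 1) ->
  (forall eta : R, 0 < eta ->
     exists n, forall m, \sum_(n <= i < m) (v i - u i) `^ s <= eta) ->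
  0 <= a -> b <= 1 -> light u v a b ->
  exists x, [/\ a <= x <= b, exact_approx_set psi x &
    forall i, ~~ (u i <= x <= v i)].
Proof.
move=> psi0 s0 s1 noninc small div uv vu1 tail a0 b1 lightab.
(* The shift by 2 keeps eps n in ]0, 1[ from n = 0 on. *)
pose eps n : R := n.+2%:R^-1.
have eps01 n : 0 < eps n /\ eps n < 1.
  by rewrite /eps invr_gt0 ltr0n invf_lt1 ?ltr0n// ltr1n.
pose ok (J : R * R) := [/\ 0 <= J.1, J.2 <= 1 & light u v J.1 J.2].
have : forall nJ : nat * (R * R), exists Jpq : (R * R) * (nat * nat),
    let n := nJ.1 in let J := nJ.2 in let J' := Jpq.1 in
    let p := Jpq.2.1 in let q := Jpq.2.2 in
    ok J -> [/\ (n < q)%N, J.1 <= J'.1 <= J'.2 /\ J'.2 <= J.2, ok J',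
      forall y, J'.1 <= y <= J'.2 ->
        (1 - eps n) * psi q%:R < `|y - p%:R / q%:R| < psi q%:R &
      forall i, (i < n)%N -> forall y, J'.1 <= y <= J'.2 -> ~~ (u i <= y <= v i)].
  move=> [n [c d]] /=.
  have [[/= c0 d1 lightcd]|] := pselect (ok (c, d)); last first.
    (* Arbitrary values where the invariant fails make the choice function total. *)
    by move=> nok; exists ((0, 0), (0%N, 0%N)) => /nok.
  have [e0 e1] := eps01 n.
  have [p [q [c' [d' [nq cd light' yP iP]]]]] :=
    exists_light_subinterval n psi0 s0 s1 noninc small div uv vu1 tail c0 d1 lightcd e0 e1.
  exists ((c', d'), (p, q)) => _ /=; split => //.
  by split => //=; lra.
move=> /choice[next nextP].
pose J := fix J n := if n is n'.+1 then (next (n', J n')).1 else (a, b).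
have okJ n : ok (J n).
  by elim: n => [//|n IHn]; have [] := nextP (n, J n) IHn.
have nextJ n := nextP (n, J n) (okJ n).
have [x xJ] : exists x, forall n, (J n.+1).1 <= x <= (J n.+1).2.
  apply: (@nested_point R (fun n => (J n.+1).1) (fun n => (J n.+1).2)) => n.
  - by have [_ [/andP[]]] := nextJ n.+1.
  - by have [_ []] := nextJ n.+1.
  - by have [_ [/andP[]]] := nextJ n.
have xab : a <= x <= b.
  by have [_ [/=]] := nextJ 0%N; have := xJ 0%N => /=; lra.
exists x; split => //.
- move=> e /=; rewrite in_itv/= => /andP[e0 e1].
  split; first by rewrite in_itv/=; lra.
  apply: infinite_unbounded => n.
  (* Exceeding 1/e gives eps m <= e; exceeding n gives a denominator above n. *)
  pose m := maxn n (Num.bound e^-1).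
  have [mq _ _ /(_ x (xJ m)) /andP[low up] _] := nextJ m.
  exists ((next (m, J m)).2.1 : int, (next (m, J m)).2.2); split; last first.
    by rewrite /= (leq_ltn_trans _ mq)// leq_maxl.
  split; first by rewrite /= (leq_ltn_trans _ mq).
  apply/andP; split => //; apply: le_lt_trans low.
  rewrite ler_pM2r; last by rewrite psi0// ltr0n (leq_ltn_trans _ mq).
  rewrite lerB// /eps -[leRHS]invrK lef_pV2 ?posrE ?invr_gt0//.
  apply: (le_trans (ltW (archi_boundP _))); first by rewrite invr_ge0 ltW.
  by rewrite ler_nat !leqW// leq_maxr.
- move=> i; have [_ _ _ _] := nextJ i.+1.
  by apply; [exact: ltnSn|exact: xJ].
Qed.

(** * Bounds for Hausdorff measures *)

Lemma bounded_series_tail (R : realType) (w : nat -> R) (C eta : R) :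
  (forall i, 0 <= w i) -> (forall m, \sum_(0 <= i < m) w i <= C) -> 0 < eta ->
  exists n, forall m, \sum_(n <= i < m) w i <= eta.
Proof.
move=> w0 wC eta0; pose A := range (fun m => \sum_(0 <= i < m) w i).
have supA : has_sup A.
  split; first by exists (\sum_(0 <= i < 0) w i), 0%N.
  by exists C => _ [m _ <-].
have [_ [n _ <-] nA] := sup_adherent eta0 supA.
exists n => m; have [mn|nm] := leqP m n; first by rewrite big_geq// ltW.
have Am : A (\sum_(0 <= i < m) w i) by exists m.
have := sup_upper_bound supA Am.
rewrite (@big_cat_nat _ _ _ n 0 m)//=; last exact: ltnW.
by lra.
Qed.

Lemma diam_hull (R : realType) (delta : R) (U : set R) :
  (0 < diam U <= delta%:E)%E -> exists u d, [/\ 0 <= d, d <= delta,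
    diam U = d%:E & forall y, U y -> u <= y <= u + d].
Proof.
move=> /andP[]; case E : (diam U) => [d| |]; rewrite ?lee_fin ?lte_fin//.
move=> d0 dd; exists (inf U), d; split => //; first exact: ltW.
have dU y z : U y -> U z -> `|y - z| <= d.
  by move=> Uy Uz; rewrite -lee_fin -E; apply: ereal_sup_ubound; exists (y, z).
move=> y Uy; apply/andP; split.
  apply: ge_inf => //; exists (y - d) => z Uz.
  by have := dU y z Uy Uz; rewrite ler_norml; lra.
rewrite -lerBlDr; apply: lb_le_inf; first by exists y.
by move=> z Uz; have := dU y z Uy Uz; rewrite ler_norml; lra.
Qed.

(** As d <= d^s delta^(1-s) for d <= delta, a cover with s-sum below delta^(s-1) has total length
    below 1 and misses a point of the set. The intersection with ]0, 1[ lets the bound serve for ]0,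
    1[ too. *)
Lemma premeasure_exact_ge (R : realType) (psi : R -> R) (s delta : R) :
  (forall x : R, 0 < x -> 0 < psi x) -> 0 < s -> s <= 1 ->
  (forall x y : R, 0 < x -> x <= y ->
     y ^+ 2 * psi y `^ s <= x ^+ 2 * psi x `^ s) ->
  (forall e : R, 0 < e ->
     exists N : nat, forall n, (N <= n)%N -> n%:R ^+ 2 * psi n%:R `^ s <= e) ->
  (forall C : R, exists n, C <= \sum_(1 <= i < n) i%:R * psi i%:R `^ s) ->
  0 < delta -> delta <= 1 ->
  ((delta `^ (s - 1))%:E <=
    hausdorff_premeasure s delta (exact_approx_set psi `&` `]0%R, 1%R[))%E.
Proof.
move=> psi0 s0 s1 noninc small div d0 d1.
apply: le_ereal_inf_tmp => _ [[D U]/= [dU cov] <-].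
rewrite leNgt; apply/negP => small_sum.
(* Indices outside [D] get the degenerate interval [2, 2], which has weight 0 and misses [0, 1]. *)
have : forall i, exists ud : R * R, if i \in D then
    [/\ 0 <= ud.2, ud.2 <= delta, diam (U i) = ud.2%:E &
        forall y, U i y -> ud.1 <= y <= ud.1 + ud.2]
    else ud = (2, 0).
  move=> i; have [iD|_] := boolP (i \in D); last by exists (2, 0).
  have [u [d ud]] := diam_hull (dU i (set_mem iD)).
  by exists (u, d).
move=> /choice[ud udP].
pose u i := (ud i).1; pose d i := (ud i).2; pose v i := u i + d i.
have dd i : 0 <= d i /\ d i <= delta.
  rewrite /d; have := udP i; case: ifP => _; first by case.
  by move=> -> /=; split=> //; exact: ltW.
have vuE i : v i - u i = d i by rewrite /v; lra.
pose w i := d i `^ s; have w0 i : 0 <= w i by exact: powR_ge0.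
have wE : (\esum_(i in D) (diam (U i) `^ s) = \sum_(i <oo) (w i)%:E)%E.
  rewrite nneseries_esumT; last by move=> i; rewrite lee_fin.
  rewrite esum_mkcond; apply: eq_esum => i _.
  rewrite /w /d; have := udP i; case: ifP => _; first by move=> [_ _ -> _]; rewrite poweR_EFin.
  by move=> ->; rewrite /= powR0// gt_eqF.
rewrite wE in small_sum.
have [S [SE S_lt]] : exists S : R, (\sum_(i <oo) (w i)%:E = S%:E)%E /\ S < delta `^ (s - 1).
  have S0 : (0 <= \sum_(i <oo) (w i)%:E)%E by apply: nneseries_ge0 => i; rewrite lee_fin.
  move: small_sum S0; case: (\sum_(i <oo) (w i)%:E)%E => // S.
  by rewrite lte_fin => ? _; exists S.
have wS m : \sum_(0 <= i < m) w i <= S.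
  rewrite -lee_fin -SE -sumEFin.
  by apply: nneseries_lim_ge => i _ _; rewrite lee_fin.
have S0 : 0 <= S by have := wS 0%N; rewrite big_geq.
pose beta := S * delta `^ (1 - s).
have beta0 : 0 <= beta by rewrite mulr_ge0// powR_ge0.
have delta_inv : delta `^ (s - 1) * delta `^ (1 - s) = 1.
  by rewrite -powRD ?(gt_eqF d0) ?implybT//; have -> : s - 1 + (1 - s) = 0 by [lra]; rewrite powRr0.
have beta1 : beta < 1 by rewrite -delta_inv /beta ltr_pM2r// powR_gt0.
have dbeta m : \sum_(0 <= i < m) d i <= beta.
  apply: (@le_trans _ _ (\sum_(0 <= i < m) w i * delta `^ (1 - s))).
    apply: ler_sum => i _; have [di0 di1] := dd i.
    have {1}-> : d i = d i `^ s * d i `^ (1 - s).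
      by rewrite -powRD addrC subrK ?powRr1 ?oner_eq0.
    rewrite ler_wpM2l ?(powR_ge0 (d i) s)// ge0_ler_powR ?nnegrE ?(ltW d0)//.
    by lra.
  by rewrite -mulr_suml ler_wpM2r ?powR_ge0.
(* This interval lies inside ]0, 1[ and has length (1 + beta)/2 > beta. *)
have [x [xab Ex xuv]] : exists x, [/\ (1 - beta) / 4 <= x <= 1 - (1 - beta) / 4,
    exact_approx_set psi x & forall i, ~~ (u i <= x <= v i)].
  apply: (exact_point psi0 s0 s1 noninc small div).
  - by move=> i; have [] := dd i; rewrite -vuE subr_ge0.
  - by move=> i; have [] := dd i; rewrite -vuE; lra.
  - move=> eta eta0; have [n nP] := bounded_series_tail w0 wS eta0.
    by exists n => m; under eq_bigr do rewrite vuE; exact: nP.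
  - by lra.
  - by lra.
  - exists beta; first by lra.
    move=> m; apply: le_trans (dbeta m).
    rewrite big_mkcond/=; apply: ler_sum => i _; rewrite vuE.
    by have [di0 _] := dd i; case: ifP.
have [|i Di Uix] := cov x.
  by split => //=; rewrite in_itv/=; lra.
have := xuv i; apply/negP; rewrite negbK /v /u /d.
by have := udP i; rewrite (mem_set Di) => -[_ _ _]; exact.
Qed.

Lemma le_premeasure (R : realType) (s delta : R) (E F : set R) : E `<=` F ->
  (hausdorff_premeasure s delta E <= hausdorff_premeasure s delta F)%E.
Proof.
move=> EF; apply: ereal_inf_le_tmp => _ [DU [dU FU] <-].
by exists DU => //; split=> //; exact: subset_trans FU.
Qed.

Lemma premeasure_ge0 (R : realType) (s delta : R) (E : set R) :
  (0 <= hausdorff_premeasure s delta E)%E.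
Proof.
apply: le_ereal_inf_tmp => _ [DU _ <-]; apply: esum_ge0 => i _.
exact: poweR_ge0.
Qed.

Lemma diam_itv (R : realType) (a b : R) : a <= b -> diam `[a, b] = (b - a)%:E.
Proof.
move=> ab; apply/eqP; rewrite eq_le; apply/andP; split.
  apply: ge_ereal_sup => _ [[x y] [+ +] <-].
  rewrite /= !in_itv/= => xab yab.
  by rewrite lee_fin ler_norml; lra.
apply: ereal_sup_ubound; exists (b, a); last by rewrite /= ger0_norm// subr_ge0.
by split; rewrite /= in_itv/= lexx ab.
Qed.

Lemma premeasure_unit_itv (R : realType) (delta : R) : 0 < delta ->
  (hausdorff_premeasure 1%R delta `[0%R, 1%R] <= 1)%E.
Proof.
move=> d0; pose n := (Num.bound delta^-1).+1.
have n0 : 0 < n%:R :> R by [].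
have nd : n%:R^-1 <= delta.
  rewrite -[leRHS]invrK lef_pV2 ?posrE ?invr_gt0//.
  apply: (le_trans (ltW (archi_boundP _))); first by rewrite invr_ge0 ltW.
  by rewrite ler_nat leqnSn.
have n_gt0 : (0 < n)%N by [].
clearbody n; pose U (i : nat) : set R := `[i%:R / n%:R, i.+1%:R / n%:R]%classic.
have dU i : diam (U i) = (n%:R^-1)%:E.
  rewrite diam_itv; last by rewrite ler_pM2r ?invr_gt0// ler_nat.
  by rewrite -mulrBl -natr1 addrC addKr mul1r.
apply: ge_ereal_inf; exists (\esum_(i in `I_n) (diam (U i) `^ 1)%E).
  exists (`I_n, U) => //; split => [i _|x] /=.
    by rewrite dU lte_fin lee_fin invr_gt0 n0.
  (* The right end x = 1 is assigned to the last interval, since truncation would give the index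
     n. *)
  rewrite in_itv/= => /andP[x0 +]; rewrite le_eqVlt => /predU1P[x1|x1].
    rewrite {}x1; exists n.-1 => /=; first by rewrite prednK.
    rewrite /U /= in_itv/= prednK// divff ?gt_eqF// lexx andbT.
    by rewrite ler_pdivrMr// mul1r ler_nat leq_pred.
  have /andP[tx xt] := Num.Theory.truncn_itv (mulr_ge0 (ltW n0) x0).
  exists (Num.truncn (n%:R * x)) => /=.
    by rewrite -(ltr_nat R) (le_lt_trans tx)// gtr_pMr.
  by rewrite /U /= in_itv/= ler_pdivrMr// ler_pdivlMr// [x * _]mulrC tx ltW.
rewrite esum_fset//; last by move=> i _; exact: poweR_ge0.
under eq_fsbigr do rewrite dU poweR_EFin powRr1 ?invr_ge0 ?ler0n//.
rewrite -fsbig_ord sumEFin lee_fin sumr_const card_ord -[leLHS]mulr_natl.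
by rewrite divff// gt_eqF.
Qed.

Lemma hausdorff_measure_near (R : realType) (s : R) (E : set R) (l : \bar R) :
  (forall delta : R, 0 < delta -> delta <= 1 ->
     hausdorff_premeasure s delta E = l) ->
  hausdorff_measure s E = l.
Proof.
move=> El; apply: cvg_lim => //; apply: cvg_near_cst.
near=> delta; apply: El => //.
near: delta; exact: nbhs_right_le.
Unshelve. all: by end_near. Qed.

Lemma hausdorff_measure_pinfty (R : realType) (s : R) (E : set R) : s < 1 ->
  (forall delta : R, 0 < delta -> delta <= 1 ->
     ((delta `^ (s - 1))%:E <= hausdorff_premeasure s delta E)%E) ->
  hausdorff_measure s E = +oo%E.
Proof.
move=> s1 El; apply: cvg_lim => //; apply/cvgeyPge => A.
have t0 : 0 < 1 - s by rewrite subr_gt0.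
pose B : R := Num.max A 1; have B0 : 0 < B by rewrite lt_max ltr01 orbT.
(* For this [d0], d0^(s-1) = B. *)
pose d0 : R := B `^ (- (1 - s)^-1); have d00 : 0 < d0 by exact: powR_gt0.
near=> delta.
have dpos : 0 < delta by [].
have d1 : delta <= 1 by near: delta; exact: nbhs_right_le.
apply: le_trans (El delta dpos d1); rewrite lee_fin.
apply: (@le_trans _ _ B); first by rewrite le_max lexx.
have -> : s - 1 = - (1 - s) by rewrite opprB.
rewrite powRN -[leLHS]invrK lef_pV2 ?posrE ?invr_gt0 ?powR_gt0//.
have -> : B^-1 = d0 `^ (1 - s).
  by rewrite -powRrM mulNr mulVf ?gt_eqF// powRN powRr1// ltW.
apply: ge0_ler_powR; rewrite ?nnegrE ?ltW//.
Unshelve. all: by end_near. Qed.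

(** * Covers in the convergence case *)

(** For each q the upper inequality bounds |p| by q(|x| + psi(q)), so only finitely many pairs have
    q < N. *)
Lemma exact_approx_large_denominator (R : realType) (psi : R -> R) (x : R)
    (N : nat) : exact_approx_set psi x ->
  exists p (q : nat), (N <= q)%N /\ (0 < q)%N /\ `|x - p%:~R / q%:R| < psi q%:R.
Proof.
have half01 : (2^-1 : R) \in `]0%R, 1%R[%classic by rewrite inE/= in_itv/=; lra.
move=> /(_ 2^-1 (set_mem half01))[_]; set A := [set pq | _] => infA.
apply: contrapT => small; apply: infA.
have Asmall : A `<=` \bigcup_(q in `I_N)
    [set (p, q) | p in [set p : int | `|p%:~R| <= q%:R * (`|x| + psi q%:R)]].
  move=> [p q] [/= q0 /andP[_ pq]].
  exists q => /=.
    by rewrite ltnNge; apply/negP => Nq; apply: small; exists p, q.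
  exists p => //=.
  have q0R : 0 < q%:R :> R by rewrite ltr0n.
  rewrite -(ler_pdivrMl _ _ q0R) mulrC -[leLHS](_ : `|p%:~R / q%:R| = _); last first.
    by rewrite normrM normfV (gtr0_norm q0R).
  rewrite -[X in `|X|](subKr x) (le_trans (ler_normB _ _))//.
  by rewrite lerD2l ltW.
apply: sub_finite_set Asmall _; apply: bigcup_finite => // q _.
apply: finite_image.
pose B := Num.bound (q%:R * (`|x| + psi q%:R)).
have : finite_set [set (k%:Z - B%:Z)%R | k in `I_(2 * B).+1].
  exact: finite_image.
apply: sub_finite_set => p /= pB.
have : `|p| <= B%:Z.
  rewrite -(ler_int R) intr_norm (le_trans pB)//.
  exact/ltW/archi_boundP/(le_trans _ pB).
move=> pB'; exists (absz (p + B%:Z)); last by lia.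
by rewrite /=; lia.
Qed.

(** As psi(q) <= 1, only numerators in [-q, 2q] occur; the 3q + 1 intervals of length 2 psi(q) have
    s-sum at most 2(3q + 1) psi(q)^s <= 8q psi(q)^s. *)
Lemma premeasure_exact_le (R : realType) (psi : R -> R) (s delta eta : R)
    (N : nat) :
  (forall x : R, 0 < x -> 0 < psi x) -> 0 < s -> s <= 1 -> (0 < N)%N ->
  (forall q, (N <= q)%N -> psi q%:R <= 1 /\ 2 * psi q%:R <= delta) ->
  (forall m, \sum_(N <= q < m) q%:R * psi q%:R `^ s <= eta) ->
  (hausdorff_premeasure s delta (exact_approx_set psi) <= (8 * eta)%:E)%E.
Proof.
move=> psi0 s0 s1 N0 psiN sumN.
(* Pairs are (q, p + q): the shift by q turns the numerators into natural numbers up to 3q. *)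
pose c (x : nat * nat) : R := (x.2%:R - x.1%:R) / x.1%:R.
pose I (x : nat * nat) : set R :=
  `[c x - psi x.1%:R, c x + psi x.1%:R]%classic.
pose J := [set q : nat | (N <= q)%N] `*`` (fun q => `I_(3 * q).+1).
pose U n : set R := if unpickle n is Some x then I x else set0.
have UE x : U (pickle x) = I x by rewrite /U pickleK.
have J0 x : J x -> 0 < x.1%:R :> R.
  by move=> [/= Nx _]; rewrite ltr0n (leq_trans N0).
have dI x : J x -> diam (I x) = (2 * psi x.1%:R)%:E.
  move=> Jx; have := psi0 _ (J0 x Jx) => px.
  by rewrite diam_itv; [congr (_%:E); lra|lra].
apply: ge_ereal_inf.
exists (\esum_(i in pickle @` J) (diam (U i) `^ s)%E).
  exists (pickle @` J, U) => //; split => /=.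
    move=> _ [x Jx <-]; rewrite UE dI// lte_fin lee_fin mulr_gt0 ?psi0 ?J0//=.
    by have [] := psiN x.1 (proj1 Jx).
  move=> x Ex.
  have half01 : (2^-1 : R) \in `]0%R, 1%R[%classic by rewrite inE/= in_itv/=; lra.
  have [+ _] := Ex 2^-1 (set_mem half01); rewrite in_itv/= => /andP[x0 x1].
  have [p [q [Nq [q0 xpq]]]] := exact_approx_large_denominator N Ex.
  have q0R : 0 < q%:R :> R by rewrite ltr0n.
  have [psi1 _] := psiN q Nq.
  have pE : p%:~R = q%:R * (p%:~R / q%:R) :> R by rewrite mulrC divfK// gt_eqF.
  have pge : - q%:Z <= p.
    have : 0 < q%:R * (p%:~R / q%:R + 1) :> R.
      by rewrite mulr_gt0//; move: xpq; rewrite ltr_norml; lra.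
    by rewrite -(ler_int R) intrN mulrDr -pE; lra.
  have ple : p <= q%:Z + q%:Z.
    have : 0 < q%:R * (2 - p%:~R / q%:R) :> R.
      by rewrite mulr_gt0//; move: xpq; rewrite ltr_norml; lra.
    by rewrite -(ler_int R) intrD mulrBr -pE; lra.
  have aE : (absz (p + q%:Z))%:R = p%:~R + q%:R :> R.
    by rewrite -[q%:R in RHS]/((q%:Z)%:~R) -intrD pmulrn gez0_abs//; lia.
  exists (pickle (q, absz (p + q%:Z))).
    exists (q, absz (p + q%:Z)) => //; split => //=.
    by lia.
  rewrite UE /I /c /= in_itv/= aE addrK.
  by move: xpq; rewrite ltr_norml; lra.
rewrite (@reindex_esum _ _ _ J _ pickle); last first.
  by apply: inj_bij => x y _ _; exact: (pcan_inj pickleK).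
have -> : (\esum_(i in J) (diam (U (pickle i)) `^ s)%E =
    \esum_(i in [set q : nat | (N <= q)%N]) \esum_(j in `I_(3 * i).+1)
      ((2 * psi i%:R) `^ s)%:E)%E.
  rewrite esum_esum; last by move=> i j _ _; rewrite lee_fin powR_ge0.
  by apply: eq_esum => x Jx; rewrite UE dI// poweR_EFin.
apply: (@le_trans _ _ (\esum_(i in [set q : nat | (N <= q)%N])
    (8 * (i%:R * psi i%:R `^ s))%:E)).
  apply: le_esum => i /= Ni.
  have i0 : (0 < i)%N by exact: leq_trans Ni.
  have px : 0 < psi i%:R by rewrite psi0// ltr0n.
  rewrite esum_fset//; last by move=> j _; rewrite lee_fin powR_ge0.
  rewrite -fsbig_ord sumEFin lee_fin sumr_const card_ord -[leLHS]mulr_natl.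
  rewrite powRM// ?(ltW px)// [leLHS]mulrA [leRHS]mulrA ler_wpM2r ?powR_ge0//.
  apply: (@le_trans _ _ ((3 * i).+1%:R * 2)).
    by rewrite ler_wpM2l// ler1_powR// ler1n.
  by rewrite -!natrM ler_nat; lia.
rewrite -nneseries_esum; last first.
  by move=> i Ni; rewrite lee_fin mulr_ge0// mulr_ge0// powR_ge0.
apply: lime_le.
  by apply: is_cvg_nneseries_cond => i _ _; rewrite lee_fin mulr_ge0// mulr_ge0// powR_ge0.
apply: nearW => m; rewrite sumEFin lee_fin -mulr_sumr ler_pM2l//.
apply: le_trans (sumN m).
have [mN|Nm] := leqP m N.
  rewrite big_nat_cond big_pred0 ?big_geq// => i.
  by apply/negbTE/negP => /andP[/andP[_ im]]; rewrite leqNgt (leq_trans im).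
rewrite (@big_cat_nat _ _ _ N)//=; last exact: ltnW.
rewrite [X in X + _]big_nat_cond [X in X + _]big_pred0 ?add0r; last first.
  by move=> i; apply/negbTE/negP => /andP[/andP[_ im]]; rewrite leqNgt im.
rewrite big_nat_cond [leRHS]big_nat_cond; rewrite le_eqVlt; apply/orP; left.
by apply/eqP/eq_bigl => i; case: (N <= i)%N; rewrite ?andbT.
Qed.

(** * The two cases of the dichotomy *)

Lemma cvg_pinfty_nat_le (R : realType) (f : R -> R) (e : R) :
  f x @[x --> +oo] --> (0 : R) -> 0 < e ->
  exists N : nat, forall n, (N <= n)%N -> f n%:R <= e.
Proof.
move=> /cvgrPdist_le /[apply] -[A [_ fA]].
exists (Num.bound `|A|).+1 => n nA.
apply: le_trans (ler_norm _) _; rewrite -normrN -[- _]add0r; apply: fA.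
apply: (le_lt_trans (ler_norm _)); apply: (lt_le_trans (archi_boundP _)) => //.
by rewrite ler_nat ltnW.
Qed.

Lemma nneseries_pinfty_unbounded (R : realType) (w : nat -> R) (C : R) :
  (forall i, 0 <= w i) -> (\sum_(1 <= n <oo) (w n)%:E = +oo)%E ->
  exists n, C <= \sum_(1 <= i < n) w i.
Proof.
move=> w0 woo; apply: contrapT => noC.
suff : (\sum_(1 <= n <oo) (w n)%:E <= C%:E)%E by rewrite woo.
apply: lime_le; first by apply: is_cvg_nneseries => i _ _; rewrite lee_fin.
apply: nearW => m; rewrite sumEFin lee_fin leNgt; apply/negP => Cm.
by apply: noC; exists m; exact: ltW.
Qed.

Lemma nneseries_lt_pinfty_bounded (R : realType) (w : nat -> R) :
  (forall i, 0 <= w i) -> (\sum_(1 <= n <oo) (w n)%:E < +oo)%E ->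
  exists C, forall m, \sum_(1 <= i < m) w i <= C.
Proof.
move=> w0; have : (0 <= \sum_(1 <= n <oo) (w n)%:E)%E.
  by apply: nneseries_ge0 => i _ _; rewrite lee_fin.
case E : (\sum_(1 <= n <oo) (w n)%:E)%E => [C| |] // _ _.
exists C => m; rewrite -lee_fin -E -sumEFin.
by apply: nneseries_lim_ge => i _ _; rewrite lee_fin.
Qed.

Lemma hausdorff_measure_exact0 (R : realType) (psi : R -> R) (s : R) :
  (forall x : R, 0 < x -> 0 < psi x) -> 0 < s -> s <= 1 ->
  (forall e : R, 0 < e ->
     exists N : nat, forall n, (N <= n)%N -> n%:R ^+ 2 * psi n%:R `^ s <= e) ->
  (\sum_(1 <= n <oo) (n%:R * psi n%:R `^ s)%:E < +oo)%E ->
  hausdorff_measure s (exact_approx_set psi) = 0%E.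
Proof.
move=> psi0 s0 s1 small sum_lt.
pose w n : R := n%:R * psi n%:R `^ s.
have w0 i : 0 <= w i by rewrite mulr_ge0// powR_ge0.
have [C wC] := nneseries_lt_pinfty_bounded w0 sum_lt.
have wC0 m : \sum_(0 <= i < m) w i <= C.
  case: m => [|m]; first by rewrite big_geq//; have := wC 0%N; rewrite big_geq.
  by rewrite big_ltn// {1}/w mul0r add0r.
apply: hausdorff_measure_near => delta d0 d1.
apply/eqP; rewrite eq_le premeasure_ge0 andbT.
apply/lee_addgt0Pr => e e0; rewrite add0e.
have e80 : 0 < e / 8 by lra.
have [n tail] := bounded_series_tail w0 wC0 e80.
have ds0 : 0 < (delta / 2) `^ s by rewrite powR_gt0; lra.
have [N1 small1] := small _ ds0.
(* [n] makes the tail at most e/8, [N1] gives psi(q) <= delta/2, and 1 excludes the denominator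
   0. *)
pose N := maxn 1 (maxn n N1).
have -> : e = 8 * (e / 8) by lra.
apply: (@premeasure_exact_le _ _ _ _ _ N) => //.
- by rewrite leq_maxl.
- move=> q Nq.
  have q1 : (0 < q)%N by rewrite (leq_trans _ Nq)// leq_maxl.
  have pq : psi q%:R <= delta / 2.
    apply: (@powR_cancel_le _ _ _ s) => //; last 2 first.
    + by lra.
    + apply: le_trans (small1 q _); last by rewrite (leq_trans _ Nq)// !leq_max leqnn !orbT.
      by rewrite ler_peMl ?powR_ge0// exprn_ege1// ler1n.
    by rewrite ltW// psi0// ltr0n.
  by split; lra.
- move=> m; have [mN|Nm] := leqP m N; first by rewrite big_geq// ltW.
  have nN : (n <= N)%N by rewrite !leq_max leqnn orbT.
  apply: le_trans (tail m); rewrite [leRHS](@big_cat_nat _ _ _ N)//=; last exact: ltnW.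
  by rewrite lerDr sumr_ge0.
Qed.

(** Both measures are computed. Either set contains the part of the exact approximation set in ]0,
    1[, so its premeasures are at least delta^(s-1). For s < 1 both measures are thus infinite; for
    s = 1 both are 1, as both sets lie in [0, 1]. *)
Lemma hausdorff_measure_exact_full (R : realType) (psi : R -> R) (s : R) :
  (forall x : R, 0 < x -> 0 < psi x) -> 0 < s -> s <= 1 ->
  (forall x y : R, 0 < x -> x <= y ->
     y ^+ 2 * psi y `^ s <= x ^+ 2 * psi x `^ s) ->
  (forall e : R, 0 < e ->
     exists N : nat, forall n, (N <= n)%N -> n%:R ^+ 2 * psi n%:R `^ s <= e) ->
  (forall C : R, exists n, C <= \sum_(1 <= i < n) i%:R * psi i%:R `^ s) ->
  hausdorff_measure s (exact_approx_set psi) =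
  hausdorff_measure s `]0, 1[%classic.
Proof.
move=> psi0 s0 s1 noninc small div.
have lower (A : set R) (delta : R) : exact_approx_set psi `&` `]0%R, 1%R[ `<=` A ->
    0 < delta -> delta <= 1 ->
    ((delta `^ (s - 1))%:E <= hausdorff_premeasure s delta A)%E.
  move=> EA d0 d1; apply: le_trans (le_premeasure _ _ EA).
  exact: premeasure_exact_ge.
have subE := @subIsetl _ (exact_approx_set psi) `]0%R, 1%R[%classic.
have subI := @subIsetr _ (exact_approx_set psi) `]0%R, 1%R[%classic.
have [s_lt1|s_ge1] := ltP s 1.
  by rewrite !hausdorff_measure_pinfty// => delta; exact: lower.
have sE : s = 1 by apply/eqP; rewrite eq_le s1.
have one (A : set R) : exact_approx_set psi `&` `]0%R, 1%R[ `<=` A -> A `<=` `[0, 1] ->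
    hausdorff_measure s A = 1%E.
  move=> EA A01; apply: hausdorff_measure_near => delta d0 d1.
  apply/eqP; rewrite eq_le; apply/andP; split.
    by apply: le_trans (le_premeasure _ _ A01) _; rewrite sE premeasure_unit_itv.
  by have := lower A delta EA d0 d1; rewrite sE subrr powRr0.
rewrite !one//.
- by move=> x /=; rewrite !in_itv/= => /andP[/ltW -> /ltW ->].
- move=> x; have half01 : (2^-1 : R) \in `]0%R, 1%R[%classic.
    by rewrite inE/= in_itv/=; lra.
  by move=> /(_ 2^-1 (set_mem half01))[].
Qed.

Unset Implicit Arguments.

Theorem theorem1p2 (R : realType) (psi : R -> R) (s : R)
    (psi_gt0 : forall x : R, 0 < x -> 0 < psi x)
    (s_gt0 : 0 < s) (s_le1 : s <= 1)
    (psi_noninc : forall x y : R, 0 < x -> x <= y ->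
       y ^+ 2 * psi y `^ s <= x ^+ 2 * psi x `^ s)
    (psi_cvg0 : x ^+ 2 * psi x `^ s @[x --> +oo] --> (0 : R)) :
  ((\sum_(1 <= n <oo) (n%:R * psi n%:R `^ s)%:E < +oo)%E ->
     hausdorff_measure s (exact_approx_set psi) = 0%E) /\
  ((\sum_(1 <= n <oo) (n%:R * psi n%:R `^ s)%:E = +oo)%E ->
     hausdorff_measure s (exact_approx_set psi) =
     hausdorff_measure s `]0, 1[%classic).
Proof.
have small e := @cvg_pinfty_nat_le _ _ e psi_cvg0.
split; first exact: hausdorff_measure_exact0.
move=> sum_oo; apply: hausdorff_measure_exact_full => // C.
by apply: nneseries_pinfty_unbounded => // i; rewrite mulr_ge0// powR_ge0.
Qed.
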